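(* Let $(X,T,\Omega,P,\theta)$ be a random countable topological Markov chain with the b.i.p.-property and let $\varphi$ be a potential such that $(\hat{\mathrm{H}})$ holds and $\mathcal{L}_\omega(1)=1$ a.s. Then there exist $s\in(0,1)$ and a positive random variable $c^\ast_\omega$ such that, for each pair of random probability measures $\mu,\nu$, each $n\in\mathbb{N}$ and a.e. $\omega\in\Omega$, with $\mu^n_\omega:=(\mathcal{L}^n_\omega)^\ast(\mu_{\theta^n\omega})$ and $\nu^n_\omega:=(\mathcal{L}^n_\omega)^\ast(\nu_{\theta^n\omega})$, $$W\big(\mu^n_{\theta^{-n}\omega},\nu^n_{\theta^{-n}\omega}\big)\le c^\ast_\omega\,s^n\,W(\mu_\omega,\nu_\omega)\quad\text{and}\quad W\big(\mu^n_\omega,\nu^n_\omega\big)\le c^\ast_\omega\,s^n\,W(\mu_{\theta^n\omega},\nu_{\theta^n\omega}).$$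
   Context: **Random countable topological Markov chain.** $\theta$ is an ergodic automorphism (invertible, bimeasurable, probability preserving, ergodic) of a probability space $(\Omega,\mathcal{F},P)$; $\{\mathcal{W}^1_\omega\}$ is a measurable family of subsets of $\mathbb{N}$; for a.e. $\omega$, $A_\omega=(\alpha^\omega_{ij}:i\in\mathcal{W}^1_\omega,j\in\mathcal{W}^1_{\theta\omega})$ is a matrix with entries in $\{0,1\}$, measurable in $\omega$, with $\sum_{j\in\mathcal{W}^1_{\theta\omega}}\alpha^\omega_{ij}>0$ and $\sum_{j\in\mathcal{W}^1_{\theta^{-1}\omega}}\alpha^{\theta^{-1}\omega}_{ji}>0$ for all $i\in\mathcal{W}^1_\omega$. Put $X_\omega=\{(x_0,x_1,\dots):\alpha^{\theta^i\omega}_{x_ix_{i+1}}=1\ \forall i\ge0\}$, $T_\omega:X_\omega\to X_{\theta\omega}$ the shift, $X=\{(\omega,x):x\in X_\omega\}$ (measurable structure induced from $\mathbb{N}^{\mathbb{N}}\times\Omega$), $T(\omega,x)=(\theta\omega,T_\omega x)$, $T^n_\omega=T_{\theta^{n-1}\omega}\circ\cdots\circ T_\omega$. $\mathcal{W}^n_\omega$ is the set of $\omega$-admissible words $(x_0,\dots,x_{n-1})$, i.e. $x_i\in\mathcal{W}^1_{\theta^i\omega}$ and $\alpha^{\theta^i\omega}_{x_ix_{i+1}}=1$ for consecutive letters; $[a]_\omega=\{x\in X_\omega:x_i=a_i,\ 0\le i<n\}$; $\Omega_a=\{\omega:[a]_\omega\neq\emptyset\}$; $\mathcal{W}^n$ is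 the set of words $a$ of length $n$ with $P(\Omega_a)>0$. For $r\in(0,1)$, $d_r(x,y)=r^{\min\{i:x_i\ne y_i\}}$. **Random probability measure** $\mu=\{\mu_\omega\}$: a map $(B,\omega)\mapsto\mu_\omega(B)\in[0,1]$ on (Borel sets of $\mathbb{N}^{\mathbb{N}}$)$\times\Omega$ which is measurable in $\omega$ for each $B$ and such that, for a.e. $\omega$, $\mu_\omega$ is a probability measure with support $X_\omega$. **b.i.p.-property.** $(X,T)$ is topologically mixing if for all $a,b\in\mathcal{W}^1$ there is an $\mathbb{N}$-valued random variable $N_{ab}$ such that $[a]_\omega\cap(T^n_\omega)^{-1}[b]_{\theta^n\omega}\neq\emptyset$ whenever $n\ge N_{ab}(\omega)$, $a\in\mathcal{W}^1_\omega$ and $\theta^n\omega\in\Omega_b$. $(X,T)$ has the b.i.p.-property if it is topologically mixing and there are $\Omega_{\rm bi},\Omega_{\rm bp}\subset\Omega$ of positive measure and a finite $\mathcal{I}\subset\mathbb{N}$ such that (1) for $\omega\in\Omega_{\rm bi}$, $a\in\mathcal{W}^1_{\theta^{-1}\omega}$ there is $b\in\mathcal{I}$ with $ab\in\mathcal{W}^2_{\theta^{-1}\omega}$; (2) for $\omega\in\Omega_{\rm bp}$, $a\in\mathcal{W}^1_\omega$ there is $b\in\mathcal{I}$ with $ba\in\mathcal{W}^2_{\theta^{-1}\omega}$. **Hölder continuity.** For $f:X\to\mathbb{R}$, $f_\omega=f|_{X_\omega}$, $V^\omega_n(f)=\sup\{|f_\omega(x)-f_\omega(y)|:x_i=y_i,\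 0\le i<n\}$. $f$ is locally Hölder continuous with parameter $r$ and index $k$ if there is a random variable $\kappa\ge0$ with $\int\log\kappa\,dP<\infty$ and $V^\omega_n(f)\le\kappa(\omega)r^n$ for all $n\ge k$. **Ruelle operator.** For measurable $\varphi:X\to\mathbb{R}$, $\mathcal{L}_\omega(f)(x)=\sum_{y\in X_\omega:T_\omega y=x}e^{\varphi_\omega(y)}f(y)$ ($x\in X_{\theta\omega}$), $\mathcal{L}^n_\omega=\mathcal{L}_{\theta^{n-1}\omega}\circ\cdots\circ\mathcal{L}_\omega$, $\int f\,d(\mathcal{L}^n_\omega)^\ast(\mu)=\int\mathcal{L}^n_\omega(f)\,d\mu$. $(\hat{\mathrm{H}})$: $\varphi$ is locally Hölder continuous with index $2$ (with parameter $r$ and random variable $\kappa$) and $V^\omega_1(\varphi)<\infty$ for a.e. $\omega\in\theta^{-1}(\Omega_{\rm bi}\cup\Omega_{\rm bp})$. **Vasershtein distance.** $W(\mu,\nu)=\inf\int d_r\,dm$ over all couplings $m$ of the probability measures $\mu,\nu$ on the same fibre (i.e. with marginals $\mu,\nu$), where $r$ is the Hölder parameter of $\varphi$. *)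

(* Defs.v *)
From HB Require Import structures.
From mathcomp Require Import all_boot all_order all_algebra.
From mathcomp Require Import all_classical all_reals all_analysis measurable_realfun.

Set Implicit Arguments.
Unset Strict Implicit.
Unset Printing Implicit Defensive.

Import Order.TTheory GRing.Theory Num.Theory.
Import numFieldNormedType.Exports.

Local Open Scope classical_set_scope.
Local Open Scope ring_scope.
Local Open Scope ereal_scope.

(* N^N with the Borel sigma-algebra of the product of the discrete topologies. *)
Definition baire := g_sigma_algebraType (@open {ptws nat -> nat}).

Definition seq_shift (x : baire) : baire := fun i => x i.+1.

(* [alpha w i j] is an entry of the matrix A_w only when i belongs to          *)
(* [letters w] and j to [letters (theta w)]; its other values are never used.  *)
Record rtmc (d : measure_display) (Omega : measurableType d) (R : realType)
    (P : probability Omega R) := RTMC {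
  theta : Omega -> Omega ;
  thetaV : Omega -> Omega ;
  thetaK : cancel theta thetaV ;
  thetaVK : cancel thetaV theta ;
  theta_measurable : measurable_fun [set: Omega] theta ;
  thetaV_measurable : measurable_fun [set: Omega] thetaV ;
  theta_preserving : forall B, measurable B -> P (theta @^-1` B) = P B ;
  theta_ergodic : forall B, measurable B -> theta @^-1` B = B ->
    P B = 0 \/ P B = 1 ;
  letters : Omega -> set nat ;
  alpha : Omega -> nat -> nat -> bool ;
  letters_measurable : forall i, measurable [set w | letters w i] ;
  alpha_measurable : forall i j,
    measurable [set w | [/\ letters w i, letters (theta w) j & alpha w i j]] ;
  row_col_pos : {ae P, forall w, forall i, letters w i ->
    0 < \esum_(j in letters (theta w)) ((alpha w i j)%:R : R)%:E /\
    0 < \esum_(j in letters (thetaV w)) ((alpha (thetaV w) j i)%:R : R)%:E }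
}.

Section Chain.
Context {d : measure_display} {Omega : measurableType d} {R : realType}.
Context {P : probability Omega R} (X : rtmc P).

Local Notation thetan n := (iter n (theta X)).

Definition fiber (w : Omega) : set baire :=
  [set x | forall i, [/\ letters X (thetan i w) (x i),
                         letters X (thetan i.+1 w) (x i.+1)
                       & alpha X (thetan i w) (x i) (x i.+1)]].

Definition total_space : set (Omega * baire) := [set p | fiber p.1 p.2].

Definition words (n : nat) (w : Omega) : set (seq nat) :=
  [set a | [/\ size a = n,
    forall i, (i < n)%N -> letters X (thetan i w) (nth 0%N a i) &
    forall i, (i.+1 < n)%N ->
      alpha X (thetan i w) (nth 0%N a i) (nth 0%N a i.+1)]].

Definition cylinder (a : seq nat) (w : Omega) : set baire :=
  [set x | fiber w x /\ forall i, (i < size a)%N -> x i = nth 0%N a i].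

Definition Omega_ (a : seq nat) : set Omega := [set w | cylinder a w !=set0].

(* [Omega_ a] is measurable only up to a null set, and the value of P on a    *)
(* non-measurable set is arbitrary; hence positive measure is expressed as    *)
(* non-negligibility.                                                         *)
Definition global_words (n : nat) : set (seq nat) :=
  [set a | size a = n /\ ~ P.-negligible (Omega_ a)].

Definition top_mixing : Prop :=
  forall a b : nat, global_words 1 [:: a] -> global_words 1 [:: b] ->
  exists2 N : Omega -> nat, measurable_fun [set: Omega] N &
    {ae P, forall w, forall n, (N w <= n)%N -> letters X w a ->
      Omega_ [:: b] (thetan n w) ->
      cylinder [:: a] w `&` (iter n seq_shift @^-1` cylinder [:: b] (thetan n w))
        !=set0 }.

(* The b.i.p.-property, with its witnesses Omega_bi and Omega_bp explicit      *)
(* because the hypothesis on the potential refers to them.                     *)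
Definition bip (Obi Obp : set Omega) : Prop :=
  [/\ top_mixing,
      measurable Obi /\ 0 < P Obi,
      measurable Obp /\ 0 < P Obp &
      exists I : set nat, [/\ finite_set I,
        forall w a, Obi w -> letters X (thetaV X w) a ->
          exists2 b, I b & words 2 (thetaV X w) [:: a; b] &
        forall w a, Obp w -> letters X w a ->
          exists2 b, I b & words 2 (thetaV X w) [:: b; a]]].

Definition fiber_variation (n : nat) (f : Omega -> baire -> R) (w : Omega) : \bar R :=
  ereal_sup [set t | exists x y, [/\ fiber w x, fiber w y,
    forall i, (i < n)%N -> x i = y i & t = (`|f w x - f w y|%R)%:E]].

(* The integral of log kappa is < +oo when its positive part has a finite      *)
(* integral: [\int[P]_w lne (kappa w)%:E < +oo] alone would also hold in the   *)
(* undefined case, where the library sets +oo - +oo to -oo.                    *)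
Definition locally_holder (r : R) (k : nat) (f : Omega -> baire -> R) : Prop :=
  exists kappa : Omega -> R,
    [/\ measurable_fun [set: Omega] kappa,
        (forall w, (0 <= kappa w)%R),
        \int[P]_w ((fun v => lne (kappa v)%:E)^\+ w) < +oo &
        {ae P, forall w, forall n, (k <= n)%N ->
          fiber_variation n f w <= (kappa w * r ^+ n)%:E}].

Definition Hhat (Obi Obp : set Omega) (r : R) (phi : Omega -> baire -> R) :
    Prop :=
  locally_holder r 2 phi /\
  {ae P, forall w, (theta X @^-1` (Obi `|` Obp)) w -> fiber_variation 1 phi w < +oo}.

(* [esum] is a sum only for nonnegative terms: f is meant to be nonnegative.   *)
Definition ruelle (phi : Omega -> baire -> R) (w : Omega) (f : baire -> \bar R)
    : baire -> \bar R :=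
  fun x => \esum_(y in [set y | fiber w y /\ seq_shift y = x])
             ((expR (phi w y))%:E * f y).

Fixpoint ruellen (phi : Omega -> baire -> R) (n : nat) (w : Omega)
    (f : baire -> \bar R) : baire -> \bar R :=
  if n is m.+1 then ruelle phi (thetan m w) (ruellen phi m w f) else f.

(* The measure (L^n_w)^*(mu), given by its value on each set B, that is, by    *)
(* the duality relation for the indicator function of B.                       *)
Definition dual_ruellen (phi : Omega -> baire -> R) (n : nat) (w : Omega)
    (mu : set baire -> \bar R) : set baire -> \bar R :=
  fun B => \int[mu]_x ruellen phi n w (EFin \o \1_B) x.

(* mu^n_w := (L^n_w)^*(mu_{theta^n w})                                         *)
Definition pull (phi : Omega -> baire -> R) (n : nat)
    (mu : Omega -> set baire -> \bar R) (w : Omega) : set baire -> \bar R :=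
  dual_ruellen phi n w (mu (thetan n w)).

Definition msupport (mu : set baire -> \bar R) : set baire :=
  [set x | forall U : set {ptws nat -> nat}, open U -> U x -> 0 < mu U].

Definition random_probability (mu : Omega -> set baire -> \bar R) : Prop :=
  [/\ forall w B, measurable B -> 0 <= mu w B <= 1,
      forall B, measurable B -> measurable_fun [set: Omega] (mu ^~ B) &
      {ae P, forall w,
        (exists m : probability baire R, forall B, measurable B -> mu w B = m B)
        /\ msupport (mu w) = fiber w}].

End Chain.

Section Vasershtein.
Context {R : realType}.

Definition dist_seq (r : R) (x y : baire) : R :=
  match pselect (exists i, x i != y i) with
  | left neq_xy => (r ^+ ex_minn neq_xy)%R
  | right _ => 0%R
  end.

Definition coupling (mu nu : set baire -> \bar R)
    (m : probability (baire * baire)%type R) : Prop :=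
  forall B, measurable B -> m (B `*` setT) = mu B /\ m (setT `*` B) = nu B.

Definition vasershtein (r : R) (mu nu : set baire -> \bar R) : \bar R :=
  ereal_inf [set \int[m]_p (dist_seq r p.1 p.2)%:E | m in coupling mu nu].

End Vasershtein.

(* Main.v *)
(** For [x], [y] in a fibre, the dual operators carry the point masses at [x] and
    [y] to the laws of random backward extensions [a x], [b y].  If [x] and [y]
    share their first letter, the same word [a] can be prepended with probability
    at least [1 - D * d(x, y)], where the distortion [D] is controlled by
    [B(w) = sum_(j >= 1) kap(theta^-j w) * t^j], [t = sqrt r]; hence the metric
    [Delta_w = min(1, B(w) * d_r)] is never expanded, and is contracted by [t]
    wherever [Delta < 1].  If [Delta = 1], the b.p. property and topological mixing
    give, over a block of fixed length over a set of positive measure of base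
    points, a uniformly positive chance that independent extensions share a fixed
    long prefix, hence a uniform contraction.  By Garsia's maximal inequality, the
    number of such blocks along almost every orbit is bounded below by a linear
    function, while [B(theta^n w)] grows subexponentially by Borel-Cantelli. *)

Require Import Defs.
From HB Require Import structures.
From mathcomp Require Import all_boot all_order all_algebra.
From mathcomp Require Import all_classical all_reals all_analysis measurable_realfun giry.
From mathcomp Require Import ring lra zify.

Set Implicit Arguments.
Unset Strict Implicit.
Unset Printing Implicit Defensive.

Import Order.TTheory GRing.Theory Num.Theory.
Import numFieldNormedType.Exports.

Local Open Scope classical_set_scope.
Local Open Scope ring_scope.
Local Open Scope ereal_scope.

(** * Mixtures of point masses *)

(** The weight [B] solves [B(theta w) = t * (kap w + B w)]. Over [n >= 1] steps this gives
    [B w * r ^ n + D <= t * B(theta^n w)]: per unit of [d_r], the cost of a matched pair plus the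
    probability of a mismatch is at most [t] times the old weight. Adding [t^-1] to the Hoelder
    variable forces [B >= 1], so that [Delta < 1] implies a common first letter and
    [d_r <= Delta_w <= B(w) * d_r]. The factor lost in returning to [d_r] is [B] at the end of the
    stretch: it is fixed in the first inequality and absorbed by half of the exponential rate in the
    second. The obstacle is that everything a strongly contracting block depends on is random: the
    size of [B], the mixing times, the distortion. These are frozen to constants on one set of
    positive measure, which must be measurable for its visits to be counted; hence the minorization
    is tested only at measurably chosen points of the fibres. All couplings are explicit countable
    sums, measurable in the pair of points, which replaces a selection of optimal couplings. *)

Section CountableSums.
Context {R : realType} {I : countType}.
Implicit Types a : I -> \bar R.

(** [unpickle] may decode several integers to the same index; the guard [pickle k == i] keeps one
    integer per index, so each term is counted once. *)
Lemma esum_countE a : (forall k, 0 <= a k) ->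
  \esum_(k in [set: I]) a k =
  \sum_(i <oo) (if unpickle i is Some k then
                  if pickle k == i then a k else 0 else 0).
Proof.
move=> a0; pose b i := if unpickle i is Some k then
  if pickle k == i then a k else 0 else 0.
have b0 i : 0 <= b i by rewrite /b; case: unpickle => // k; case: ifP.
rewrite (nneseries_esumT b0).
rewrite (esumID (range (@pickle I))) ?setTI; last by move=> *; exact: b0.
rewrite [X in _ + X]esum1 ?adde0; last first.
  move=> i /= ni; rewrite /b; case: unpickle => // k.
  by case: eqP => // ki; case: ni; exists k.
rewrite esum_image; last by move=> x y _ _; exact: (pcan_inj pickleK).
by apply: eq_esum => k _; rewrite /b pickleK eqxx.
Qed.

Lemma measurable_esum d (T : measurableType d) (f : I -> T -> \bar R) :
  (forall k, measurable_fun setT (f k)) -> (forall k x, 0 <= f k x) ->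
  measurable_fun setT (fun x => \esum_(k in [set: I]) f k x).
Proof.
move=> mf f0; rewrite (_ : (fun x => _) = fun x => \sum_(i <oo)
    (if unpickle i is Some k then if pickle k == i then f k x else 0 else 0)).
  2: by apply/funext => x; rewrite esum_countE.
apply: ge0_emeasurable_sum => [i x _ _|i _].
  by case: unpickle => // k; case: ifP.
by case: unpickle => [k|]; [case: (_ == _)|]; rewrite //; exact: measurable_cst.
Qed.

Lemma esum_ge_term a k : (forall k, 0 <= a k) ->
  a k <= \esum_(k in [set: I]) a k.
Proof.
move=> a0; apply: esum_ge; exists [set k]; last by rewrite fsbig_set1.
by split; [exact: finite_set1|].
Qed.

(** [c] may be [+oo], since it will be a value of an unbounded test function. In that case either
    some term is positive and both sides are [+oo], or all terms vanish. *)
Lemma esumZl (c : \bar R) a : 0 <= c -> (forall k, 0 <= a k) ->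
  \esum_(k in [set: I]) (c * a k) = c * \esum_(k in [set: I]) a k.
Proof.
move=> + a0; case: c => [c|_|//].
  rewrite lee_fin => c0; rewrite !esum_countE//; last first.
    by move=> k; rewrite mule_ge0.
  rewrite -nneseriesZl; last by move=> i _; case: unpickle => // k; case: ifP.
  apply: eq_eseriesr => i _; case: unpickle => [k|]; rewrite ?mule0//.
  by case: ifP => _; rewrite ?mule0.
have [[k ak]|na] := pselect (exists k, 0 < a k).
  have ya : +oo * a k = +oo by rewrite gt0_mulye.
  rewrite gt0_mulye; last by apply: lt_le_trans ak (esum_ge_term k a0).
  apply/eqP; rewrite -leye_eq -{1}ya.
  by apply: (esum_ge_term (a := fun k => +oo * a k)) => j; rewrite mule_ge0// leey.
have az k : a k = 0.
  apply/eqP; rewrite eq_le a0 andbT leNgt; apply/negP => ak.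
  by apply: na; exists k.
by rewrite esum1 ?esum1 ?mule0// => k _; rewrite az mule0.
Qed.

End CountableSums.

Section Mixture.
Context d d' (Z : measurableType d) (Y : measurableType d') (R : realType).
Context (I : countType) (q : I -> Z -> R) (h : I -> Z -> Y).
Hypothesis q0 : forall k p, (0 <= q k p)%R.
Hypothesis mq : forall k, measurable_fun setT (q k).
Hypothesis mh : forall k, measurable_fun setT (h k).
Hypothesis q1 : forall p, \esum_(k in [set: I]) (q k p)%:E <= 1.

(** The atoms are numbered by integer codes so that the mixture is an [mseries] and inherits its
    measure structure; integers coding no index carry the zero measure. *)
Definition mixture_atom (p : Z) (i : nat) : {measure set Y -> \bar R} :=
  if unpickle i is Some k then
    if pickle k == i then
      mscale (NngNum (q0 k p)) (\d_(h k p)) : {measure set Y -> \bar R}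
    else (mzero : {measure set Y -> \bar R})
  else (mzero : {measure set Y -> \bar R}).

Definition mixture_fun (p : Z) : set Y -> \bar R := mseries (mixture_atom p) 0.

HB.instance Definition _ p := Measure.on (mixture_fun p).

Lemma integral_mixture_fun p (F : Y -> \bar R) :
  measurable_fun setT F -> (forall y, 0 <= F y) ->
  \int[mixture_fun p]_y F y = \esum_(k in [set: I]) ((q k p)%:E * F (h k p)).
Proof.
move=> mF F0; rewrite ge0_integral_measure_series//.
rewrite esum_countE; last by move=> k; rewrite mule_ge0// lee_fin.
apply: eq_eseriesr => i _; rewrite /mixture_atom.
case: unpickle => [k|]; last by rewrite integral_measure_zero.
case: ifP => _; last by rewrite integral_measure_zero.
by rewrite ge0_integral_mscale// integral_dirac// diracT mul1e.
Qed.

Lemma mixture_funE p B : measurable B ->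
  mixture_fun p B = \esum_(k in [set: I]) ((q k p)%:E * (\1_B (h k p))%:E).
Proof.
move=> mB; have mF : measurable_fun setT (EFin \o (\1_B : Y -> R)).
  by apply/measurable_EFinP; exact: measurable_indic.
rewrite -(integral_mixture_fun p mF) ?integral_indic ?setIT//.
by move=> y; rewrite lee_fin.
Qed.

Lemma mixture_fun_setT p : mixture_fun p setT <= 1.
Proof.
rewrite mixture_funE//; apply: le_trans (q1 p); apply: le_esum => k _.
by rewrite indicT mule1.
Qed.

HB.instance Definition _ p := Measure_isSubProbability.Build _ _ _
  (mixture_fun p) (mixture_fun_setT p).

Definition mixture (p : Z) : giry Y R := mixture_fun p.

Lemma measurable_mixture : measurable_fun setT mixture.
Proof.
apply: measurable_giry_codensity => // B mB.
rewrite (_ : _ ^~ B =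
  fun p => \esum_(k in [set: I]) ((q k p)%:E * (\1_B (h k p))%:E)); last first.
  by apply/funext => p; rewrite /mixture/= mixture_funE.
apply: measurable_esum => [k|k p]; last by rewrite mule_ge0 ?lee_fin.
apply: emeasurable_funM; first exact/measurable_EFinP.
by apply/measurable_EFinP; apply: measurableT_comp.
Qed.

(** The mixtures form a measurable map into the Giry space, which is bound against [m]. Mass one is
    required only on average: the kernel used for couplings vanishes off the fibres, on a null set
    of [m]. *)
Lemma mixture_probability (m : probability Z R) :
  \int[m]_p (\esum_(k in [set: I]) (q k p)%:E) = 1 ->
  exists m' : probability Y R, forall F : Y -> \bar R,
    measurable_fun setT F -> (forall y, 0 <= F y) ->
    \int[m']_y F y = \int[m]_p \esum_(k in [set: I]) ((q k p)%:E * F (h k p)).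
Proof.
move=> m1; pose mu := giry_bind m measurable_mixture.
have muE F : measurable_fun setT F -> (forall y, 0 <= F y) ->
    \int[mu]_y F y = \int[m]_p \esum_(k in [set: I]) ((q k p)%:E * F (h k p)).
  move=> mF F0; rewrite -[LHS]/(giry_int mu F) giry_int_bind//.
  by apply: eq_integral => p _; rewrite /giry_int integral_mixture_fun.
have muT : mu setT = 1.
  rewrite -(setIT setT) -integral_indic// muE//.
    rewrite -m1; apply: eq_integral => p _; apply: eq_esum => k _.
    by rewrite /= indicT mule1.
  by apply/measurable_EFinP; exact: measurable_indic.
pose mu' : {measure set Y -> \bar R} := mu.
pose Pmu := Measure_isProbability.Build _ _ _ mu' muT.
pose m' : probability Y R := HB.pack (Measure.sort mu') Pmu.
by exists m' => F mF F0; rewrite -muE.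
Qed.

End Mixture.

(** * The Baire space *)

Lemma measurable_cst_set d (T : measurableType d) (Q : Prop) :
  measurable [set _ : T | Q].
Proof.
have [q|nq] := pselect Q.
  by rewrite (_ : mkset _ = setT)//; apply/seteqP; split.
by rewrite (_ : mkset _ = set0)//; apply/seteqP; split.
Qed.

Section BaireMeasurable.

Definition bcyl (a : seq nat) : set baire :=
  [set x | forall i, (i < size a)%N -> x i = nth 0%N a i].

Lemma bcyl_mkseq (x : baire) n (y : baire) :
  bcyl (mkseq x n) y <-> forall i, (i < n)%N -> y i = x i.
Proof.
rewrite /bcyl/= size_mkseq; split=> xy i ni; last by rewrite nth_mkseq// xy.
by rewrite xy// nth_mkseq.
Qed.

Lemma open_coordinate i j : open [set x : {ptws nat -> nat} | x i = j].
Proof.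
have ci : continuous (fun x : {ptws nat -> nat} => x i).
  move=> x; have /pointwise_cvgP H : {ptws, nbhs x --> x} by exact: cvg_id.
  exact: (H i).
exact: ((@continuousP {ptws nat -> nat} nat _).1 ci [set j] (discrete_open _)).
Qed.

(** Otherwise points outside [U] that agree with [x] on longer and longer prefixes would converge to
    [x] pointwise. *)
Lemma open_bcyl (U : set {ptws nat -> nat}) (x : baire) : open U -> U x ->
  exists n, bcyl (mkseq x n) `<=` U.
Proof.
move=> oU Ux; apply: contrapT => /forallNP H.
have /choice[y yP] n : exists y : baire, bcyl (mkseq x n) y /\ ~ U y.
  by have /existsNP[y /not_implyP yP] := H n; exists y.
have : {ptws, y @ \oo --> x}.
  apply/pointwise_cvgP => i.
  suff : (fun n => y n i) @ \oo --> x i by [].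
  move=> B /nbhs_singleton Bxi; exists i.+1 => // n /= ni.
  by rewrite /= ((bcyl_mkseq _ _ _).1 (yP n).1).
move=> /(_ U (open_nbhs_nbhs (conj oU Ux))) [n _] /(_ n (leqnn _)).
by have [] := yP n.
Qed.

Lemma measurable_coordinate i j : measurable [set x : baire | x i = j].
Proof. by apply: sub_sigma_algebra; exact: open_coordinate. Qed.

Lemma open_bigcup_bcyl (U : set {ptws nat -> nat}) : open U ->
  U = \bigcup_(a in [set a | bcyl a `<=` U]) bcyl a.
Proof.
move=> oU; apply/seteqP; split=> [x Ux|x [a aU /aU//]].
have [n nU] := open_bcyl oU Ux.
by exists (mkseq x n) => //; exact/bcyl_mkseq.
Qed.

Context d (T : measurableType d).

Lemma measurable_preimage_bcyl (f : T -> baire) a :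
  (forall i j, measurable [set t | f t i = j]) -> measurable (f @^-1` bcyl a).
Proof.
move=> mf; rewrite (_ : _ @^-1` _ = \bigcap_(i < size a) [set t | f t i = nth 0%N a i]).
  by apply: bigcap_measurableType => i _.
by apply/seteqP; split.
Qed.

(** Words are countable, so each open set is a countable union of cylinders and measurability can be
    tested on coordinates. *)
Lemma measurable_fun_baire (f : T -> baire) :
  (forall i j, measurable [set t | f t i = j]) -> measurable_fun setT f.
Proof.
move=> mf; apply: (@measurability _ _ T baire setT f (@open {ptws nat -> nat})) => //.
move=> _ [U oU <-]; rewrite setTI (open_bigcup_bcyl oU) preimage_bigcup.
rewrite bigcup_mkcond; apply: countable_bigcupT_measurable => [|a].
  exact: countableP.
by case: ifP => // _; exact: measurable_preimage_bcyl.
Qed.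

Lemma measurable_baire_coordinate (f : T -> baire) i j :
  measurable_fun setT f -> measurable [set t | f t i = j].
Proof.
move=> mf; rewrite -[X in measurable X]setTI.
by apply: (mf measurableT [set x : baire | x i = j]); exact: measurable_coordinate.
Qed.

End BaireMeasurable.

Lemma measurable_bcyl a : measurable (bcyl a : set baire).
Proof.
by apply: (@measurable_preimage_bcyl _ baire id) => i j; exact: measurable_coordinate.
Qed.

(** Prepending [a]: the inverse branch, along [a], of the shift iterated [size a] times. *)
Definition scat (a : seq nat) (x : baire) : baire :=
  fun i => if (i < size a)%N then nth 0%N a i else x (i - size a)%N.

Lemma measurable_scat a : measurable_fun setT (scat a).
Proof.
apply: measurable_fun_baire => i j; rewrite /scat.
by case: ltnP => _; [exact: measurable_cst_set|exact: measurable_coordinate].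
Qed.

Lemma iter_shiftE n (x : baire) i : iter n seq_shift x i = x (n + i)%N.
Proof. by elim: n i => [|n IH] i //=; rewrite /seq_shift IH addSnnS. Qed.

Lemma measurable_iter_shift n : measurable_fun setT (iter n seq_shift).
Proof.
apply: measurable_fun_baire => i j; under eq_set do rewrite iter_shiftE.
exact: measurable_coordinate.
Qed.

Lemma shift_scat a x : iter (size a) seq_shift (scat a x) = x.
Proof.
by apply/funext => i; rewrite iter_shiftE /scat ltnNge leq_addr addKn.
Qed.

Lemma scat_shift n (y : baire) : scat (mkseq y n) (iter n seq_shift y) = y.
Proof.
apply/funext => i; rewrite /scat size_mkseq iter_shiftE.
by case: ltnP => [?|/subnKC->//]; rewrite nth_mkseq.
Qed.

Lemma mkseq_scat a x : mkseq (scat a x) (size a) = a.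
Proof.
apply: (@eq_from_nth _ 0%N); rewrite size_mkseq// => i ia.
by rewrite nth_mkseq// /scat ia.
Qed.

Lemma scat_cat a b x : scat (a ++ b) x = scat a (scat b x).
Proof.
apply/funext => i; rewrite /scat size_cat nth_cat.
have [ia|ai] := ltnP i (size a); first by rewrite ltn_addr.
by rewrite ltn_subLR// subnDA.
Qed.

(** * The metric [dist_seq] and prepending of words *)

Section Distance.
Context {R : realType} (r : R).
Hypothesis r01 : (0 < r < 1)%R.
Implicit Types x y : baire.

Lemma dist_seqxx x : dist_seq r x x = 0%R.
Proof.
rewrite /dist_seq; case: pselect => // e; exfalso.
by case: e => i; rewrite eqxx.
Qed.

Lemma dist_seqE x y n : (forall i, (i < n)%N -> x i = y i) -> x n != y n ->
  dist_seq r x y = (r ^+ n)%R.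
Proof.
move=> xy xyn; rewrite /dist_seq; case: pselect => [e|]; last by case; exists n.
congr (_ ^+ _)%R; case: ex_minnP => m xym mmin; apply/eqP.
rewrite eqn_leq mmin//=; rewrite leqNgt; apply/negP => /xy xym'.
by rewrite xym' eqxx in xym.
Qed.

Lemma dist_seqP x y : x = y \/
  exists n, [/\ forall i, (i < n)%N -> x i = y i, x n != y n &
                dist_seq r x y = (r ^+ n)%R].
Proof.
have [[i xyi]|H] := pselect (exists i, x i != y i); last first.
  left; apply/funext => i; apply/eqP; apply: contra_notT H => xyi.
  by exists i.
right; have e : exists i, x i != y i by exists i.
case: (ex_minnP e) => n xyn nmin; exists n.
have xy i' : (i' < n)%N -> x i' = y i'.
  by move=> i'n; apply/eqP; apply: contraTT i'n => /nmin; rewrite leqNgt.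
by split=> //; exact: dist_seqE.
Qed.

Lemma dist_seq_ge0 x y : (0 <= dist_seq r x y)%R.
Proof.
case: (dist_seqP x y) => [->|[n [_ _ ->]]]; rewrite ?dist_seqxx// exprn_ge0//.
by case/andP: r01 => /ltW.
Qed.

Lemma dist_seq_agree x y n : (forall i, (i < n)%N -> x i = y i) ->
  (dist_seq r x y <= r ^+ n)%R.
Proof.
have /andP[/ltW r0 /ltW r1] := r01.
case: (dist_seqP x y) => [->|[m [_ xym ->]]] xy.
  by rewrite dist_seqxx exprn_ge0.
rewrite ler_wiXn2l//; rewrite leqNgt; apply/negP => /xy xym'.
by rewrite xym' eqxx in xym.
Qed.

Lemma dist_seq_le1 x y : (dist_seq r x y <= 1)%R.
Proof. by rewrite -(expr0 r) dist_seq_agree. Qed.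

Lemma dist_seq_first x y : (dist_seq r x y < 1)%R -> x 0%N = y 0%N.
Proof.
case: (dist_seqP x y) => [->//|[[|n] [xy xyn ->]]]; last by move=> _; exact: xy.
by rewrite expr0 ltxx.
Qed.

Lemma dist_seq_scat a x y :
  dist_seq r (scat a x) (scat a y) = (r ^+ size a * dist_seq r x y)%R.
Proof.
case: (dist_seqP x y) => [->|[n [xy xyn ->]]].
  by rewrite !dist_seqxx mulr0.
rewrite -exprD; apply: dist_seqE => [i ian|]; rewrite /scat.
  by have [//|ai] := ltnP i (size a); rewrite xy// ltn_subLR.
by rewrite ltnNge leq_addr /= addKn.
Qed.

(** The distance takes countably many values: [r ^+ n] on the pairs that first differ at [n], and 0
    on the diagonal. *)
Lemma measurable_dist_seq :
  measurable_fun setT (fun p : baire * baire => dist_seq r p.1 p.2).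
Proof.
pose A n := [set p : baire * baire | (forall i, (i < n)%N -> p.1 i = p.2 i) /\
  p.1 n != p.2 n].
have mE i : measurable [set p : baire * baire | p.1 i = p.2 i].
  rewrite (_ : mkset _ = \bigcup_j ([set p : baire * baire | p.1 i = j] `&`
    [set p | p.2 i = j])).
    apply: bigcup_measurable => j _; apply: measurableI.
      apply: (measurable_baire_coordinate (f := fst)); exact: measurable_fst.
    apply: (measurable_baire_coordinate (f := snd)); exact: measurable_snd.
  apply/seteqP; split=> [p /= pi|p [j _ [/= -> ->]]//].
  by exists (p.1 i).
have mA n : measurable (A n).
  rewrite (_ : A n = \bigcap_(i < n) [set p : baire * baire | p.1 i = p.2 i] `&`
    ~` [set p | p.1 n = p.2 n]).
    apply: measurableI; last exact: measurableC.
    by apply: bigcap_measurableType.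
  by apply/seteqP; split=> p [pi /eqP pn]; split.
have mD : measurable [set p : baire * baire | p.1 = p.2].
  rewrite (_ : mkset _ = \bigcap_i [set p : baire * baire | p.1 i = p.2 i]).
    exact: bigcap_measurableType.
  apply/seteqP; split=> [p /= pe i _ /=|p pi /=]; first by rewrite pe.
  by apply/funext => i; exact: pi.
move=> _ Y mY; rewrite setTI.
rewrite (_ : _ @^-1` _ = (\bigcup_(n in [set n | Y (r ^+ n)%R]) A n) `|`
   ([set _ | Y 0%R] `&` [set p | p.1 = p.2])).
  apply: measurableU; first exact: bigcup_measurable.
  by apply: measurableI => //; exact: measurable_cst_set.
apply/seteqP; split=> [[x y]/=|[x y] /= [[n Yn [xy xyn]]|]].
- case: (dist_seqP x y) => [->|[n [xy xyn ->]]] H; last by left; exists n.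
  by right; rewrite dist_seqxx in H.
- by rewrite (dist_seqE xy xyn).
- by case=> Y0 ->; rewrite dist_seqxx.
Qed.

End Distance.

(** * Visits of an ergodic map to a set *)

Section MeasurePreserving.
Context {d : measure_display} {Omega : measurableType d} {R : realType}.
Context {P : probability Omega R} (T : Omega -> Omega).
Hypothesis mT : measurable_fun setT T.
Hypothesis PT : forall B, measurable B -> P (T @^-1` B) = P B.

Lemma ae_preserving (Q : Omega -> Prop) :
  {ae P, forall w, Q w} -> {ae P, forall w, Q (T w)}.
Proof.
move=> [N [mN N0 QN]]; exists (T @^-1` N); split.
- by rewrite -[X in measurable X]setTI; exact: mT.
- by rewrite PT.
- by move=> w /= nQ; apply: QN.
Qed.

Lemma ae_preserving_iter (Q : Omega -> Prop) n :
  {ae P, forall w, Q w} -> {ae P, forall w, Q (iter n T w)}.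
Proof.
move=> aeQ; elim: n => // n /ae_preserving.
by apply: filterS => w; rewrite -iterSr.
Qed.

Lemma ae_orbit (Q : Omega -> Prop) :
  {ae P, forall w, Q w} -> {ae P, forall w, forall n, Q (iter n T w)}.
Proof. by move=> aeQ; apply/ae_foralln => n; exact: ae_preserving_iter. Qed.

Lemma measurable_iter n : measurable_fun setT (iter n T).
Proof.
elim: n => [|n IH]; first exact: measurable_id.
by rewrite (_ : iter n.+1 T = T \o iter n T)//; exact: measurableT_comp.
Qed.

Lemma ge0_integral_preserving (g : Omega -> \bar R) :
  measurable_fun setT g -> (forall w, 0 <= g w) ->
  \int[P]_w g (T w) = \int[P]_w g w.
Proof.
move=> mg g0; rewrite -[LHS](@ge0_integral_pushforward _ _ _ _ _ _ mT P setT g)//.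
by apply: eq_measure_integral => A mA _; exact: PT.
Qed.

Definition visits (A : set Omega) n w := (\sum_(k < n) (iter k T w \in A))%N.

Lemma visitsS A n w : visits A n.+1 w = ((w \in A) + visits A n (T w))%N.
Proof.
rewrite /visits big_ord_recl/=; congr addn.
by apply: eq_bigr => i _; rewrite -iterSr.
Qed.

Lemma measurable_mem (A : set Omega) : measurable A ->
  measurable_fun setT (fun w => nat_of_bool (w \in A)).
Proof.
move=> mA _ Y _; rewrite setTI.
rewrite (_ : _ @^-1` _ = (A `&` [set _ | Y 1%N]) `|` (~` A `&` [set _ | Y 0%N])).
  apply: measurableU; apply: measurableI.
  - by [].
  - exact: measurable_cst_set.
  - exact: measurableC.
  - exact: measurable_cst_set.
apply/seteqP; split=> w /=.
  by have [wA|wA] := pselect (A w); [rewrite mem_set//; left|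
    rewrite memNset//; right].
by case=> -[wA]; [rewrite mem_set|rewrite memNset].
Qed.

Lemma measurable_visits A n : measurable A -> measurable_fun setT (visits A n).
Proof.
move=> mA; elim: n => [|n IH].
  by apply: (eq_measurable_fun (cst 0%N)) => // w _; rewrite /visits big_ord0.
apply: (eq_measurable_fun (fun w => (w \in A) + visits A n (T w))%N).
  by move=> w _; rewrite visitsS.
apply: measurable_fun_addn; first exact: measurable_mem.
exact: measurableT_comp.
Qed.

(* The running maximum of [k - q * visits A k w] over [k <= n]. *)
Fixpoint excess (q : nat) (A : set Omega) (n : nat) (w : Omega) : nat :=
  if n is m.+1 then ((excess q A m (T w)).+1 - q * (w \in A))%N else 0%N.

Variables (q : nat) (A : set Omega).
Hypothesis mA : measurable A.

Lemma measurable_excess n : measurable_fun setT (excess q A n).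
Proof.
elim: n => [|n IH]; first exact: measurable_cst.
apply: measurable_fun_subn.
  apply: (@measurable_fun_addn _ _ _ (cst 1%N) (fun w => excess q A n (T w))).
    exact: measurable_cst.
  exact: measurableT_comp.
elim: (q) => [|k IHk]; first exact: measurable_cst.
apply: measurable_fun_addn; first exact: measurable_mem.
exact: IHk.
Qed.

Lemma excess_le n w : (excess q A n w <= n)%N.
Proof. by elim: n w => //= n IH w; rewrite leq_subLR (leq_trans _ (leq_addl _ _))// ltnS. Qed.

Lemma excess_mono n w : (excess q A n w <= excess q A n.+1 w)%N.
Proof. by elim: n w => // n IH w; rewrite leq_sub2r// ltnS IH. Qed.

Lemma excess_visits n w : (n <= q * visits A n w + excess q A n w)%N.
Proof.
elim: n w => // n IH w; rewrite visitsS /=.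
move: (IH (T w)) => /=; move: (visits _ _ _) (excess _ _ _ _) => v e.
by case: (w \in A); rewrite ?muln0 ?muln1; nia.
Qed.

Let E n := [set w | (0 < excess q A n w)%N].

Let mE n : measurable (E n).
Proof.
rewrite -[X in measurable X]setTI.
by apply: (measurable_excess n measurableT (Y := [set k | (0 < k)%N])).
Qed.

(** Garsia's argument. Where the excess is positive its truncation is inactive, which gives the
    pointwise bound [pt]. After integration, invariance of [P] and monotonicity in [n] make the
    integrals of the excess cancel; they are finite because the excess is bounded for each [n]. *)
Let excess_mass n : (q%:R)%:E * P (A `&` E n) <= 1.
Proof.
case: n => [|n].
  rewrite (_ : _ `&` _ = set0) ?measure0 ?mule0//.
  by apply/seteqP; split=> w // [_] /=.
pose f n w : \bar R := (excess q A n w)%:R%:E.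
have mf m : measurable_fun setT (f m).
  apply/measurable_EFinP.
  by apply: (measurableT_comp (f := fun k : nat => k%:R : R)) (measurable_excess m).
have f0 m w : 0 <= f m w by rewrite lee_fin.
have mAE : measurable (A `&` E n.+1) by exact: measurableI.
have pt w : f n.+1 w + (q%:R)%:E * (\1_(A `&` E n.+1) w)%:E <= f n (T w) + 1.
  rewrite /f -EFinM -!EFinD lee_fin -natrM -natrD -[1%R]/(1%:R) -natrD ler_nat.
  have -> : (w \in A `&` E n.+1) = (w \in A) && (0 < excess q A n.+1 w)%N.
    by rewrite in_setI; congr andb; apply/idP/idP; rewrite inE.
  rewrite /=; move: (excess _ _ _ _) => k.
  case: (w \in A); last by rewrite !muln0 subn0 addn0 addn1.
  by rewrite muln1; case: ltnP; rewrite /= ?muln0 ?muln1; lia.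
have mi : measurable_fun setT (fun w => (\1_(A `&` E n.+1) w)%:E : \bar R).
  by apply/measurable_EFinP; exact: measurable_indic.
have mqi : measurable_fun setT
    (fun w => q%:R%:E * (\1_(A `&` E n.+1) w)%:E : \bar R).
  exact: measurable_funeM.
have qi0 w : 0 <= q%:R%:E * (\1_(A `&` E n.+1) w)%:E :> \bar R.
  by rewrite mule_ge0 ?lee_fin.
have mfT : measurable_fun setT (fun w => f n (T w)) by exact: measurableT_comp.
have : \int[P]_w (f n.+1 w + (q%:R)%:E * (\1_(A `&` E n.+1) w)%:E) <=
       \int[P]_w (f n (T w) + 1).
  apply: ge0_le_integral => //.
  - by move=> w _; apply: adde_ge0.
  - exact: emeasurable_funD.
  - exact: emeasurable_funD.
have int_cst c : \int[P]_w (cst c w) = c.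
  rewrite integral_cst//; apply: etrans (mule1 c); congr (_ * _).
  exact: probability_setT.
rewrite !ge0_integralD// ge0_integral_preserving// int_cst.
rewrite ge0_integralZl_EFin// integral_indic// setIT.
have fle : \int[P]_w f n w <= \int[P]_w f n.+1 w.
  by apply: ge0_le_integral => // w _; rewrite lee_fin ler_nat excess_mono.
have ffin : \int[P]_w f n.+1 w \is a fin_num.
  rewrite ge0_fin_numE ?integral_ge0//.
  apply: (@le_lt_trans _ _ (\int[P]_w (n.+1%:R)%:E)).
    by apply: ge0_le_integral => // w _; rewrite lee_fin ler_nat excess_le.
  by rewrite int_cst ltry.
move=> H; have {H} := le_trans H (leeD2r 1 fle).
by rewrite leeD2lE.
Qed.

Hypothesis ergodicT : forall B, measurable B -> T @^-1` B = B ->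
  P B = 0 \/ P B = 1.

(* If the running maximum were unbounded on a set of positive measure, then by
   ergodicity almost everywhere, and Garsia's argument [excess_mass] would give
   [q * P A <= 1]. *)
Lemma visits_linear : 1 < (q%:R)%:E * P A ->
  {ae P, forall w, exists K, forall n, (n <= q * visits A n w + K)%N}.
Proof.
move=> qA; pose B := [set w | forall K, exists n, (K < excess q A n w)%N].
have BE : B = \bigcap_K \bigcup_n [set w | (K < excess q A n w)%N].
  by apply/seteqP; split=> w Bw K; [case: (Bw K) => n; exists n|
    case: (Bw K) => // n; exists n].
have mB : measurable B.
  rewrite BE; apply: bigcapT_measurable => K; apply: bigcupT_measurable => n.
  rewrite -[X in measurable X]setTI.
  by apply: (measurable_excess n measurableT (Y := [set k | (K < k)%N])).
(* The excess at [w] with index [n.+1] and the excess at [T w] with index [n] differ by at most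
   [q + 1], so unboundedness is invariant. *)
have invB : T @^-1` B = B.
  apply/seteqP; split=> w Bw K.
    by have [n Kn] := Bw (K + q)%N; exists n.+1 => /=; case: (w \in A); nia.
  have [[//|n] /= Kn] := Bw K.+1; exists n.
  by move: Kn; case: (w \in A); nia.
have [B0|B1] := ergodicT mB invB.
  exists B; split=> // w nH; move: nH; apply: contra_notP.
  move=> /existsNP[K /forallNP HK]; exists K => n.
  rewrite (leq_trans (excess_visits n w))// leq_add2l leqNgt.
  by apply/negP; exact: HK.
have BU : B `<=` \bigcup_n E n by move=> w /(_ 0%N) [n]; exists n.
have mU : measurable (\bigcup_n E n) by exact: bigcupT_measurable.
have PU : P (\bigcup_n E n) = 1.
  apply/eqP; rewrite eq_le probability_le1//= -B1.
  by apply: le_measure; rewrite ?inE.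
have PAU : P (A `&` \bigcup_n E n) = P A.
  apply/eqP; rewrite eq_le; apply/andP; split.
    by apply: le_measure; rewrite ?inE//; exact: measurableI.
  have -> : P A = P (A `\` \bigcup_n E n) + P (A `&` \bigcup_n E n).
    exact: measureDI.
  rewrite (_ : P (A `\` _) = 0) ?add0e//.
  apply/eqP; rewrite eq_le measure_ge0 andbT.
  rewrite (@le_trans _ _ (P (~` \bigcup_n E n)))//.
    apply: le_measure; rewrite ?inE; [exact: measurableD|exact: measurableC|].
    by move=> w [].
  by rewrite probability_setC// PU subee.
exfalso; move: qA; apply/negP; rewrite -leNgt -PAU.
have cvgP : P (A `&` E n) @[n --> \oo] --> P (A `&` \bigcup_n E n).
  rewrite setI_bigcupr; apply: nondecreasing_cvg_mu.
  - by move=> n; exact: measurableI.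
  - by apply: bigcupT_measurable => n; exact: measurableI.
  - apply/nondecreasing_seqP => n; apply/subsetPset; apply: setIS => w /=.
    by move=> /leq_trans; apply; exact: excess_mono.
have : (q%:R)%:E * P (A `&` E n) @[n --> \oo] -->
       (q%:R)%:E * P (A `&` \bigcup_n E n) by exact: cvgeZl.
move=> /cvg_lim <-//; apply: lime_le; last exact: nearW.
by apply: is_cvgeZl => //; apply/cvg_ex; eexists; exact: cvgP.
Qed.

End MeasurePreserving.

(** * Growth along orbits *)

(** The supremum of the sequence is measurable. On the exceptional set, where it may be [+oo],
    [fine] sends it to 0; the added 1 makes the bound positive everywhere. *)
Lemma measurable_upper_bound {d} {T : measurableType d} {R : realType}
    (mu : {measure set T -> \bar R}) (u : nat -> T -> R) :
  (forall n, measurable_fun setT (u n)) -> (forall n w, (0 <= u n w)%R) ->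
  {ae mu, forall w, exists K, forall n, (u n w <= K)%R} ->
  exists c : T -> R, [/\ measurable_fun setT c, forall w, (0 < c w)%R &
    {ae mu, forall w, forall n, (u n w <= c w)%R}].
Proof.
move=> mu_ u0 bu; pose s w := esups (fun n => (u n w)%:E) 0%N.
have sE w : s w = ereal_sup (range (fun n => (u n w)%:E)).
  by rewrite /s /esups /sdrop; congr ereal_sup; apply/seteqP; split=> x [n _ <-]; exists n.
have us n w : (u n w)%:E <= s w.
  by rewrite sE; apply: ereal_sup_ubound; exists n.
have s0 w : 0 <= s w by apply: le_trans (us 0%N w); rewrite lee_fin.
exists (fun w => (1 + fine (s w))%R); split.
- apply: measurable_funD; first exact: measurable_cst.
  apply: measurableT_comp; first exact: fine_measurable.
  by apply: measurable_fun_esups => n; exact/measurable_EFinP.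
- by move=> w; rewrite ltr_wpDr// fine_ge0.
apply: filterS bu => w [K uK] n.
have sfin : s w \is a fin_num.
  rewrite ge0_fin_numE// (@le_lt_trans _ _ K%:E) ?ltry// sE.
  by apply: ge_ereal_sup => _ [k _ <-]; rewrite lee_fin.
by rewrite (@le_trans _ _ (fine (s w)))// ?lerDr// -lee_fin fineK.
Qed.

Section Growth.
Context {d : measure_display} {Omega : measurableType d} {R : realType}.
Context {P : probability Omega R} (T : Omega -> Omega).
Hypothesis mT : measurable_fun setT T.
Hypothesis PT : forall B, measurable B -> P (T @^-1` B) = P B.
Variable kappa : Omega -> R.
Hypothesis mkappa : measurable_fun setT kappa.
Hypothesis kappa0 : forall w, (0 <= kappa w)%R.
Hypothesis ikappa : \int[P]_w ((fun v => lne (kappa v)%:E)^\+ w) < +oo.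

Let L w := (fun v => lne (kappa v)%:E)^\+ w.

Let L0 w : 0 <= L w. Proof. exact: funepos_ge0. Qed.

Let mL : measurable_fun setT L.
Proof.
apply: measurable_funepos.
rewrite (_ : (fun v => _) =
  fun v => if (kappa v <= 0)%R then -oo else (ln (kappa v))%:E)//.
apply: measurable_fun_ifT => //; first exact: measurable_fun_ler.
by apply/measurable_EFinP; apply: measurableT_comp => //; exact: measurable_ln.
Qed.

(** Layer-cake bound: at most [l / e + 1] integers [n] satisfy [n * e < l]. *)
Let tail_sum (e : R) N (l : \bar R) : (0 < e)%R -> 0 <= l ->
  \sum_(n < N) (if (n%:R * e)%:E < l then e%:E else 0) <= l + e%:E.
Proof.
move=> e0; case: l => [l| |]//; last first.
  by move=> _; rewrite addye// leey.
rewrite lee_fin => l0.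
elim: N => [|N IH].
  by rewrite big_ord0 -EFinD lee_fin addr_ge0// ltW.
rewrite big_ord_recr/=; case: ifPn => [|_]; last by rewrite adde0.
rewrite lte_fin => Nl; rewrite leeD2r//.
apply: (@le_trans _ _ (\sum_(n < N) e%:E)).
  by apply: lee_sum => i _; case: ifP; rewrite // lee_fin ltW.
by rewrite sumEFin lee_fin sumr_const card_ord -mulr_natl ltW.
Qed.

Let mtail x : measurable [set w | x%:E < L w].
Proof. by rewrite -[X in measurable X]setTI; exact: emeasurable_fun_o_infty. Qed.

(** Stationarity replaces [L (iter n T w)] by [L w] inside the probability, and [tail_sum] then
    bounds [e] times the sum by the integral of [L] plus [e]. *)
Let summable_tail (e : R) : (0 < e)%R ->
  \sum_(n <oo) P [set w | (n%:R * e)%:E < L (iter n T w)] < +oo.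
Proof.
move=> e0.
have int_cst c : \int[P]_w (cst c w) = c.
  rewrite integral_cst//; apply: etrans (mule1 c); congr (_ * _).
  exact: probability_setT.
have PE n : P [set w | (n%:R * e)%:E < L (iter n T w)] =
            P [set w | (n%:R * e)%:E < L w].
  elim: n (n%:R * e)%R => // n IH x.
  rewrite -[RHS]IH -[RHS]PT.
    by congr (P _); apply/seteqP; split=> w /=; rewrite -iterSr.
  have -> : [set w | x%:E < L (iter n T w)] = iter n T @^-1` [set w | x%:E < L w].
    by [].
  rewrite -[X in measurable X]setTI.
  exact: (measurable_iter mT n measurableT (mtail _)).
have bnd : e%:E * \sum_(n <oo) P [set w | (n%:R * e)%:E < L (iter n T w)] <=
    \int[P]_w L w + e%:E.
  rewrite -nneseriesZl//; apply: lime_le.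
    by apply: is_cvg_nneseries => n _ _; rewrite mule_ge0// lee_fin ltW.
  apply: nearW => N; rewrite big_mkord.
  rewrite (_ : \sum_(n < N) _ = \int[P]_w
    \sum_(n < N) (if (n%:R * e)%:E < L w then e%:E else 0)).
    rewrite -[X in _ + X]int_cst -ge0_integralD//; last first.
      by move=> w _; rewrite lee_fin ltW.
    apply: ge0_le_integral => //.
    - by move=> w _; apply: sume_ge0 => i _; case: ifP; rewrite // lee_fin ltW.
    - apply: emeasurable_sum => i; apply: measurable_fun_ifT => //.
      exact: measurable_fun_lte.
    - exact: emeasurable_funD.
    - by move=> w _; exact: tail_sum.
  rewrite ge0_integral_sum//; last 2 first.
  - move=> i; apply: measurable_fun_ifT => //; exact: measurable_fun_lte.
  - by move=> i w _; case: ifP; rewrite // lee_fin ltW.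
  apply: eq_bigr => i _; rewrite PE.
  rewrite -[X in P X]setIT -integral_indic// -ge0_integralZl_EFin//; last 2 first.
  - by apply/measurable_EFinP; exact: measurable_indic.
  - exact: ltW.
  apply: eq_integral => w _; rewrite indicE.
  case: ifPn => wi; first by rewrite mem_set// mule1.
  by rewrite memNset ?mule0//; exact/negP.
have : e%:E * \sum_(n <oo) P [set w | (n%:R * e)%:E < L (iter n T w)] < +oo.
  by apply: le_lt_trans bnd _; rewrite lte_add_pinfty ?ltry.
have : 0 <= \sum_(n <oo) P [set w | (n%:R * e)%:E < L (iter n T w)].
  by apply: nneseries_ge0.
case: (\sum_(n <oo) _) => [x|//|//]; rewrite ?ltry//.
by rewrite muleC gt0_mulye ?lte_fin.
Qed.

(** Borel-Cantelli with [e = - ln eta]: from some index on, [L (iter n T w) <= n * e], which gives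
    [kappa (iter n T w) * eta ^+ n <= 1]. The finitely many earlier terms are added to the
    constant. *)
Lemma orbit_growth (eta : R) : (0 < eta < 1)%R ->
  {ae P, forall w, exists K, forall n, (kappa (iter n T w) * eta ^+ n <= K)%R}.
Proof.
move=> /andP[eta0 eta1]; pose e := (- ln eta)%R.
have e0 : (0 < e)%R by rewrite oppr_gt0 ln_lt0// eta0.
pose F n := [set w | (n%:R * e)%:E < L (iter n T w)].
have mF n : measurable (F n).
  rewrite -[X in measurable X]setTI.
  exact: (measurable_iter mT n measurableT (mtail _)).
have F0 : P (lim_sup_set F) = 0.
  by apply: lim_sup_set_cvg0 => //; exact: summable_tail.
exists (lim_sup_set F); split=> //.
  by apply: bigcap_measurableType => n _; apply: bigcup_measurable => k _; exact: mF.
move=> w; apply: contra_notP => /existsNP[m] /not_implyP[_ wF].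
have kap n : (m <= n)%N -> (kappa (iter n T w) * eta ^+ n <= 1)%R.
  move=> mn; have {wF} : ~ F n w by move=> Fn; apply: wF; exists n.
  move=> /negP; rewrite -leNgt /L funeposE.
  have [->|k0] := eqVneq (kappa (iter n T w)) 0%R; first by rewrite mul0r.
  have kp : (0 < kappa (iter n T w))%R by rewrite lt_neqAle eq_sym k0 kappa0.
  rewrite ge_max => /andP[+ _].
  rewrite /lne (lt_geF kp) lee_fin /e mulrN => H.
  rewrite -[leLHS]lnK ?posrE ?mulr_gt0 ?exprn_gt0// -expR0 ler_expR.
  rewrite lnM ?posrE ?exprn_gt0// lnXn//.
  by rewrite -[(ln eta *+ n)%R]mulr_natl -lerBrDr sub0r.
exists (1 + \sum_(n < m) kappa (iter n T w) * eta ^+ n)%R => n.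
have sum0 : (0 <= \sum_(n < m) kappa (iter n T w) * eta ^+ n)%R.
  by apply: sumr_ge0 => i _; rewrite mulr_ge0// exprn_ge0// ltW.
have [mn|nm] := leqP m n; first by rewrite (le_trans (kap _ mn))// lerDl.
rewrite (bigD1 (Ordinal nm))//= addrCA lerDl addr_ge0//.
by apply: sumr_ge0 => i _; rewrite mulr_ge0// exprn_ge0// ltW.
Qed.

End Growth.

(** * Fibres and the Ruelle operator *)

Section Fibres.
Context {d : measure_display} {Omega : measurableType d} {R : realType}.
Context {P : probability Omega R} (X : rtmc P).
Implicit Types (w : Omega) (x y : baire) (a : seq nat).

Local Notation th n := (iter n (theta X)).

Lemma measurable_total_space : measurable (total_space X).
Proof.
pose S i j := [set w | [/\ letters X w i, letters X (theta X w) j & alpha X w i j]].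
rewrite (_ : total_space X = \bigcap_k \bigcup_i \bigcup_j
    ((fun p => th k p.1) @^-1` S i j `&`
     ([set p : Omega * baire | p.2 k = i] `&` [set p | p.2 k.+1 = j]))).
  apply: bigcap_measurableType => k _; apply: bigcupT_measurable => i.
  apply: bigcupT_measurable => j; apply: measurableI.
    rewrite -[X in measurable X]setTI.
    apply: (measurableT_comp (measurable_iter (theta_measurable X) k)
      measurable_fst measurableT).
    exact: alpha_measurable.
  by apply: measurableI; apply: (measurable_baire_coordinate (f := snd));
    exact: measurable_snd.
apply/seteqP; split=> [[w x] /= wx k _|[w x] H k].
  exists (x k) => //; exists (x k.+1) => //.
  by have [? ? ?] := wx k; split.
by have [i _ [j _ [/= []]]] := H k I; rewrite -!iterS => ? ? ? [/= -> ->]; split.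
Qed.

Lemma measurable_fiber w : measurable (fiber X w).
Proof.
rewrite -[fiber X w]setTI.
exact: (pair1_measurable w measurableT measurable_total_space).
Qed.

Lemma fiber_shift n w x : fiber X w x -> fiber X (th n w) (iter n seq_shift x).
Proof.
move=> wx i; rewrite !iter_shiftE -!iterD addSn addnS (addnC i).
exact: wx.
Qed.

Lemma fiber_scat_shift n w a x : size a = n -> fiber X w (scat a x) ->
  fiber X (th n w) x.
Proof. by move=> <- /(fiber_shift (size a)); rewrite shift_scat. Qed.

(** Markov property: only the first letter of the tail takes part in the transition at the
    junction. *)
Lemma fiber_scat_first n w a x y : size a = n -> x 0%N = y 0%N ->
  fiber X w (scat a x) -> fiber X (th n w) y -> fiber X w (scat a y).
Proof.
move=> sa xy wx wy i; have := wx i; rewrite /scat sa.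
have [ian|ani] := ltnP i.+1 n; first by rewrite (ltnW ian).
have [ian|{}ani] := ltnP i n.
  have -> : n = i.+1 by apply/eqP; rewrite eqn_leq ani ian.
  by rewrite subnn xy.
move=> _; have := wy (i - n)%N.
by rewrite -!iterD -subSn// !subnK// leqW.
Qed.

End Fibres.

(** * Word weights and iterates of the Ruelle operator *)

Section Weights.
Context {d : measure_display} {Omega : measurableType d} {R : realType}.
Context {P : probability Omega R} (X : rtmc P).
Variable phi : Omega -> baire -> R.
Hypothesis mphi :
  measurable_fun (total_space X) (fun p : Omega * baire => phi p.1 p.2).
Implicit Types (w : Omega) (x y : baire) (a : seq nat).

Local Notation th n := (iter n (theta X)).

Definition birkhoff n w y : R :=
  (\sum_(k < n) phi (th k w) (iter k seq_shift y))%R.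

(** Extension by zero off the fibre lets sums run over all words and keeps the weight measurable in
    the pair [(w, y)]. *)
Definition weight n w y : R :=
  if (w, y) \in total_space X then expR (birkhoff n w y) else 0%R.

(** Words of the wrong length get weight 0, so that one countable index type serves every [n]. *)
Definition word_weight n w a x : R :=
  if size a == n then weight n w (scat a x) else 0%R.

Lemma weight_ge0 n w y : (0 <= weight n w y)%R.
Proof. by rewrite /weight; case: ifP => // _; exact: expR_ge0. Qed.

Lemma word_weight_ge0 n w a x : (0 <= word_weight n w a x)%R.
Proof. by rewrite /word_weight; case: ifP => // _; exact: weight_ge0. Qed.

Lemma weightE n w y : fiber X w y -> weight n w y = expR (birkhoff n w y).
Proof. by move=> wy; rewrite /weight mem_set. Qed.

Lemma weight_out n w y : ~ fiber X w y -> weight n w y = 0%R.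
Proof. by move=> wy; rewrite /weight memNset. Qed.

Lemma measurable_weight n :
  measurable_fun setT (fun p : Omega * baire => weight n p.1 p.2).
Proof.
rewrite (_ : (fun p => _) = fun p => if p \in total_space X then
  expR (birkhoff n p.1 p.2) else 0%R); last first.
  by apply/funext => -[w y].
apply: measurable_fun_if => //.
- apply: (measurable_fun_bool true); rewrite setTI.
  rewrite (_ : _ @^-1` _ = total_space X); first exact: measurable_total_space.
  by apply/seteqP; split=> p /=; [move/set_mem|move/mem_set].
- rewrite setTI (_ : _ @^-1` _ = total_space X); last first.
    by apply/seteqP; split=> p /=; [move/set_mem|move/mem_set].
  apply: measurableT_comp => //; apply: measurable_sum => k.
  apply: (measurable_comp (measurable_total_space X) _ mphi
    (g := fun p : Omega * baire => (th k p.1, iter k seq_shift p.2))).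
    by move=> _ [[w y] wy <-]; exact: fiber_shift.
  apply: measurable_funTS; apply: measurable_fun_pair.
    exact: (measurableT_comp (measurable_iter (theta_measurable X) k) measurable_fst).
  exact: (measurableT_comp (measurable_iter_shift k) measurable_snd).
Qed.

Lemma measurable_word_weight n w a : measurable_fun setT (word_weight n w a).
Proof.
rewrite /word_weight; case: eqP => _; last exact: measurable_cst.
apply: (measurableT_comp (f := fun y => weight n w y)).
  exact: (measurable_fun_pair2 w (measurable_weight n)).
exact: measurable_scat.
Qed.

Lemma word_weight_out n w a x : ~ fiber X (th n w) x -> word_weight n w a x = 0%R.
Proof.
rewrite /word_weight; case: eqP => // sa wx; rewrite weight_out// => wax.
exact/wx/(fiber_scat_shift sa wax).
Qed.

(** The preimages of [x] under the shift are the points [scat [:: b] x]; inadmissible letters drop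
    out because [weight] vanishes there. *)
Lemma ruelleE w (f : baire -> \bar R) x : (forall y, 0 <= f y) ->
  ruelle X phi w f x =
  \esum_(b in [set: nat]) ((weight 1 w (scat [:: b] x))%:E * f (scat [:: b] x)).
Proof.
move=> f0; rewrite /ruelle.
pose B := [set b | fiber X w (scat [:: b] x)].
rewrite (_ : mkset _ = (fun b => scat [:: b] x) @` B); last first.
  apply/seteqP; split=> [y [wy yx]|_ [b wb <-]].
    by exists (y 0%N); rewrite /B/= -?yx (scat_shift 1 y).
  by split=> //; exact: (shift_scat [:: b]).
rewrite esum_image; last first.
  by move=> b b' _ _ /(congr1 (fun y : baire => y 0%N)).
rewrite esum_mkcond; apply: eq_esum => b _; case: ifPn => [/set_mem wb|/negP wb].
  by rewrite weightE// /birkhoff big_ord1.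
by rewrite weight_out ?mul0e// => wb'; apply: wb; exact: mem_set.
Qed.

Lemma birkhoff_rcons n w a b x : size a = n ->
  birkhoff n.+1 w (scat (rcons a b) x) =
  (birkhoff n w (scat a (scat [:: b] x)) +
   birkhoff 1 (th n w) (scat [:: b] x))%R.
Proof.
move=> sa; rewrite -cats1 scat_cat /birkhoff big_ord_recr/= big_ord1.
by congr (_ + phi _ _)%R; rewrite -{1}sa shift_scat.
Qed.

Lemma word_weight_rcons n w a b x :
  word_weight n.+1 w (rcons a b) x =
  (weight 1 (th n w) (scat [:: b] x) * word_weight n w a (scat [:: b] x))%R.
Proof.
rewrite /word_weight size_rcons eqSS; case: eqP => [sa|_]; last by rewrite mulr0.
have [wab|wab] := pselect (fiber X w (scat (rcons a b) x)).
  have wb : fiber X (th n w) (scat [:: b] x).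
    by apply: (fiber_scat_shift (a := a)) => //; rewrite -scat_cat cats1.
  have wab' : fiber X w (scat a (scat [:: b] x)) by rewrite -scat_cat cats1.
  rewrite !weightE//.
  by rewrite birkhoff_rcons// expRD mulrC.
rewrite weight_out// [X in _ = (_ * X)%R]weight_out ?mulr0//.
by rewrite -scat_cat cats1.
Qed.

Lemma ruellen_ge0 n w (f : baire -> \bar R) x : (forall y, 0 <= f y) ->
  0 <= ruellen X phi n w f x.
Proof.
elim: n x => [|n IH] x f0 //=; apply: esum_ge0 => y _.
by rewrite mule_ge0 ?lee_fin ?expR_ge0 ?IH.
Qed.

(** The outermost operator of [ruellen] supplies the letter next to [x], that is, the last letter of
    the word. Hence the induction goes through [rcons], and the pairs [(b, a)] are matched with the
    nonempty words; the empty word has weight 0 at [n.+1]. *)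
Lemma ruellenE n w (f : baire -> \bar R) x : (forall y, 0 <= f y) ->
  fiber X (th n w) x ->
  ruellen X phi n w f x =
  \esum_(a in [set: seq nat]) ((word_weight n w a x)%:E * f (scat a x)).
Proof.
move=> f0; elim: n x => [|n IH] x wx.
  rewrite /= (esumID [set [::]]); last first.
    by move=> a _; rewrite mule_ge0 ?lee_fin ?word_weight_ge0.
  rewrite setTI setTI [X in _ + X]esum1 ?adde0; last first.
    by move=> [[]//|b a _]; rewrite /word_weight/= mul0e.
  have sx : scat [::] x = x by apply/funext => i; rewrite /scat subn0.
  rewrite esum_set1/= ?mule_ge0 ?lee_fin ?word_weight_ge0//.
  by rewrite /word_weight /= sx weightE// /birkhoff big_ord0 expR0 mul1e.
rewrite /= ruelleE; last by move=> y; exact: ruellen_ge0.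
transitivity (\esum_(b in [set: nat]) \esum_(a in [set: seq nat])
    ((word_weight n.+1 w (rcons a b) x)%:E * f (scat (rcons a b) x))).
  apply: eq_esum => b _.
  have [wb|wb] := pselect (fiber X (th n w) (scat [:: b] x)); last first.
    rewrite weight_out// mul0e esum1// => a _.
    by rewrite word_weight_rcons weight_out// mul0r mul0e.
  rewrite IH// -esumZl ?lee_fin ?weight_ge0//; last first.
    by move=> a; rewrite mule_ge0 ?lee_fin ?word_weight_ge0.
  apply: eq_esum => a _.
  by rewrite word_weight_rcons EFinM muleA -cats1 scat_cat.
rewrite (esum_esum (J := fun=> setT)); last first.
  by move=> *; rewrite mule_ge0 ?lee_fin ?word_weight_ge0.
rewrite (esumID [set [::]] setT); last first.
  by move=> a _; rewrite mule_ge0 ?lee_fin ?word_weight_ge0.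
rewrite setTI setTI [X in _ = X + _]esum1 ?add0e; last first.
  by move=> a ->; rewrite /word_weight/= mul0e.
apply/esym.
apply: (reindex_esum _ _ (fun k : nat * seq nat => rcons k.2 k.1)
  (fun c => (word_weight n.+1 w c x)%:E * f (scat c x))).
split.
- by move=> [b a] _ /=; case: a.
- by move=> [b a] [b' a'] _ _ /= /rcons_inj[-> ->].
- by move=> c; case/lastP: c => [/(_ erefl)//|a b _]; exists (b, a).
Qed.

Lemma measurable_ruellen n w (f : baire -> \bar R) : (forall y, 0 <= f y) ->
  measurable_fun setT f -> measurable_fun setT (ruellen X phi n w f).
Proof.
move=> f0 mf; elim: n => // n IH /=.
rewrite (_ : ruelle _ _ _ _ = fun x => \esum_(b in [set: nat])
    ((weight 1 (th n w) (scat [:: b] x))%:E *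
     ruellen X phi n w f (scat [:: b] x))); last first.
  by apply/funext => x; rewrite ruelleE// => y; exact: ruellen_ge0.
apply: measurable_esum => [b|b x]; last first.
  by rewrite mule_ge0 ?lee_fin ?weight_ge0 ?ruellen_ge0.
apply: emeasurable_funM; last first.
  by apply: (measurableT_comp (f := ruellen X phi n w f)) => //; exact: measurable_scat.
apply/measurable_EFinP; apply: (measurableT_comp (f := fun y => weight 1 (th n w) y)).
  exact: (measurable_fun_pair2 _ (measurable_weight 1)).
exact: measurable_scat.
Qed.

Lemma ruellenD m n w (f : baire -> \bar R) :
  ruellen X phi (n + m) w f = ruellen X phi n (th m w) (ruellen X phi m w f).
Proof. by elim: n => //= n ->; rewrite -iterD. Qed.

Lemma ruellen1 n w x :
  (forall k, (k < n)%N -> forall y, fiber X (th k.+1 w) y ->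
     ruelle X phi (th k w) (cst 1) y = 1) ->
  fiber X (th n w) x -> ruellen X phi n w (cst 1) x = 1.
Proof.
elim: n x => // n IH x HL wx.
rewrite -[RHS](HL n (ltnSn n) x wx).
apply: eq_esum => y [wy _]; congr (_ * _).
by apply: (etrans (IH y _ wy)) => // k kn; apply: HL; exact: ltnW.
Qed.

(** The case of the constant 1 in [ruellenE]. It makes the word weights over [x] a probability
    vector, the law of the random backward extension. *)
Lemma sum_word_weight n w x :
  (forall k, (k < n)%N -> forall y, fiber X (th k.+1 w) y ->
     ruelle X phi (th k w) (cst 1) y = 1) ->
  fiber X (th n w) x -> \esum_(a in [set: seq nat]) (word_weight n w a x)%:E = 1.
Proof.
move=> HL wx; rewrite -[RHS](ruellen1 HL wx) ruellenE//.
by apply: eq_esum => a _; rewrite mule1.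
Qed.

End Weights.

(** * Couplings of weights on a countable set *)

Section CouplingSums.
Context {R : realType} {I : countType} (u v : I -> R) (t : R).
Hypothesis u0 : forall a, (0 <= u a)%R.
Hypothesis t0 : (0 <= t)%R.
Hypothesis tuv : forall a, (t * u a <= v a)%R.

(* The part [t * u] common to [u] and [v] is put on the diagonal; the rest of [v]
   is coupled independently with [u], its total mass being [1 - t]. *)
Definition coupling_weight (k : I * I) : R :=
  (t * u k.1 * (k.1 == k.2)%:R + u k.1 * (v k.2 - t * u k.2))%R.

Lemma coupling_weight_ge0 k : (0 <= coupling_weight k)%R.
Proof.
by rewrite addr_ge0// !mulr_ge0// subr_ge0.
Qed.

Let v0 a : (0 <= v a)%R.
Proof. by apply: le_trans (tuv a); rewrite mulr_ge0. Qed.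

Lemma esum_delta (a : I) (c : \bar R) : 0 <= c ->
  \esum_(b in [set: I]) (if a == b then c else 0) = c.
Proof.
move=> c0; rewrite (esumID [set a]); last by move=> b _; case: ifP.
rewrite !setTI [X in _ + X]esum1 ?adde0; last first.
  by move=> b /= ba; case: eqP => // ab; case: ba.
by rewrite esum_set1 eqxx.
Qed.

Lemma esum_pair (f : I * I -> \bar R) : (forall k, 0 <= f k) ->
  \esum_(k in [set: I * I]) f k =
  \esum_(a in [set: I]) \esum_(b in [set: I]) f (a, b).
Proof.
move=> f0; rewrite (esum_esum (J := fun=> setT) (a := fun a b => f (a, b)))//.
rewrite (_ : setT `*`` _ = setT); last by apply/seteqP.
by apply: eq_esum => -[].
Qed.

Lemma esum_pair_swap (f : I * I -> \bar R) : (forall k, 0 <= f k) ->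
  \esum_(k in [set: I * I]) f k =
  \esum_(b in [set: I]) \esum_(a in [set: I]) f (a, b).
Proof.
move=> f0; rewrite -(esum_pair (f := fun k => f (k.2, k.1)))//.
rewrite (reindex_esum setT setT (fun k : I * I => (k.2, k.1)))//.
by split=> //; [move=> [a b] [a' b'] _ _ /= [-> ->]|move=> [a b] _; exists (b, a)].
Qed.

Hypothesis su : \esum_(a in [set: I]) (u a)%:E = 1.
Hypothesis sv : \esum_(a in [set: I]) (v a)%:E = 1.

Let eu0 a : 0 <= (u a)%:E :> \bar R. Proof. by rewrite lee_fin. Qed.

Let rest0 b : (0 <= v b - t * u b)%R. Proof. by rewrite subr_ge0. Qed.

Let erest0 b : 0 <= (v b - t * u b)%:E :> \bar R. Proof. by rewrite lee_fin. Qed.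

Let tu0 a : 0 <= (t * u a)%:E :> \bar R. Proof. by rewrite lee_fin mulr_ge0. Qed.

Let q0 k : 0 <= (coupling_weight k)%:E :> \bar R.
Proof. by rewrite lee_fin coupling_weight_ge0. Qed.

Let sum_rest : \esum_(b in [set: I]) (v b - t * u b)%:E = (1 - t)%:E.
Proof.
have : \esum_(b in [set: I]) ((v b - t * u b)%:E + t%:E * (u b)%:E) = 1.
  by rewrite -[RHS]sv; apply: eq_esum => b _; rewrite -EFinM -EFinD subrK.
rewrite esumD//; last by move=> *; rewrite mule_ge0// lee_fin.
rewrite esumZl ?lee_fin// su mule1.
have : 0 <= \esum_(b in [set: I]) (v b - t * u b)%:E by exact: esum_ge0.
by case: esum => // x _; rewrite -EFinD => -[<-]; rewrite addrK.
Qed.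

(** The diagonal part gives [t * u a] and the product part [u a * (1 - t)]. *)
Lemma coupling_weight_row a :
  \esum_(b in [set: I]) (coupling_weight (a, b))%:E = (u a)%:E.
Proof.
rewrite (_ : esum _ _ = \esum_(b in [set: I])
   ((if a == b then (t * u a)%:E else 0) + (u a)%:E * (v b - t * u b)%:E)).
  rewrite esumD; last 2 first.
  - by move=> b _; case: ifP.
  - by move=> b _; rewrite mule_ge0.
  rewrite esum_delta// esumZl// sum_rest -EFinM -EFinD.
  by congr EFin; ring.
apply: eq_esum => b _; rewrite /coupling_weight/=.
by case: (a == b); rewrite ?mulr1 ?mulr0 ?add0r ?add0e -?EFinM -?EFinD.
Qed.

Lemma coupling_weight_col b :
  \esum_(a in [set: I]) (coupling_weight (a, b))%:E = (v b)%:E.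
Proof.
rewrite (_ : esum _ _ = \esum_(a in [set: I])
   ((if b == a then (t * u b)%:E else 0) + (v b - t * u b)%:E * (u a)%:E)).
  rewrite esumD; last 2 first.
  - by move=> a _; case: ifP.
  - by move=> a _; rewrite mule_ge0.
  rewrite esum_delta// esumZl//.
  by rewrite su mule1 -EFinD addrC subrK.
apply: eq_esum => a _; rewrite /coupling_weight/= [b == a]eq_sym.
case: eqP => [->|_]; rewrite ?mulr1 ?mulr0 ?add0r ?add0e -?EFinM -?EFinD //.
  by congr (_ + _)%:E; rewrite mulrC.
by rewrite mulrC.
Qed.

Lemma coupling_weight_fst (g : I -> \bar R) : (forall a, 0 <= g a) ->
  \esum_(k in [set: I * I]) ((coupling_weight k)%:E * g k.1) =
  \esum_(a in [set: I]) ((u a)%:E * g a).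
Proof.
move=> g0; rewrite esum_pair; last by move=> k; rewrite mule_ge0.
apply: eq_esum => a _ /=; rewrite -coupling_weight_row muleC -esumZl//.
by apply: eq_esum => b _; rewrite muleC.
Qed.

Lemma coupling_weight_snd (g : I -> \bar R) : (forall a, 0 <= g a) ->
  \esum_(k in [set: I * I]) ((coupling_weight k)%:E * g k.2) =
  \esum_(b in [set: I]) ((v b)%:E * g b).
Proof.
move=> g0; rewrite esum_pair_swap; last by move=> k; rewrite mule_ge0.
apply: eq_esum => b _ /=; rewrite -coupling_weight_col muleC -esumZl//.
by apply: eq_esum => a _; rewrite muleC.
Qed.

Lemma coupling_weight_sum :
  \esum_(k in [set: I * I]) (coupling_weight k)%:E = 1.
Proof.
rewrite -[RHS]su -[RHS](eq_esum (a := fun a => (u a)%:E * cst 1 a)); last first.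
  by move=> a _; rewrite mule1.
rewrite -coupling_weight_fst//.
by apply: eq_esum => k _; rewrite mule1.
Qed.

(** The part put on the diagonal has mass [t] and costs at most [c]; the rest has mass [1 - t] and
    costs at most 1. *)
Lemma coupling_cost_le (F : I * I -> \bar R) (c : R) : (t <= 1)%R ->
  (forall k, 0 <= F k <= 1) -> (0 <= c)%R -> (forall a, F (a, a) <= c%:E) ->
  \esum_(k in [set: I * I]) ((coupling_weight k)%:E * F k) <=
  (t * c + (1 - t))%:E.
Proof.
move=> t1 F01 c0 Fc.
have -> : (t * c + (1 - t))%:E = \esum_(a in [set: I])
    ((u a)%:E * (t * c + (1 - t))%:E).
  rewrite (eq_esum (b := fun a => (t * c + (1 - t))%:E * (u a)%:E)).
    by rewrite esumZl ?su ?mule1// lee_fin addr_ge0 ?mulr_ge0// subr_ge0.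
  by move=> a _; rewrite muleC.
rewrite esum_pair; last by move=> k; rewrite mule_ge0//; case/andP: (F01 k).
apply: le_esum => a _.
rewrite (_ : _ * _ = \esum_(b in [set: I])
  ((if a == b then (u a * (t * c))%:E else 0) + (u a)%:E * (v b - t * u b)%:E)).
  apply: le_esum => b _; rewrite /coupling_weight/=.
  have /andP[F0 F1] := F01 (a, b).
  rewrite EFinD ge0_muleDl ?lee_fin ?mulr_ge0//.
  apply: leeD; last by rewrite -EFinM -[leRHS]mule1 lee_wpmul2l// lee_fin mulr_ge0.
  case: eqP => [<-|_]; last by rewrite mulr0 mul0e.
  have -> : (u a * (t * c) = t * u a * c)%R by ring.
  by rewrite mulr1 [leRHS]EFinM lee_wpmul2l.
rewrite esumD; last 2 first.
- by move=> b _; case: ifP; rewrite // lee_fin !mulr_ge0.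
- by move=> b _; rewrite mule_ge0.
rewrite esum_delta ?lee_fin ?mulr_ge0// esumZl// sum_rest -!EFinM -EFinD.
by congr EFin; ring.
Qed.

End CouplingSums.

(** For [t = 0] the coupling is the product. It gives [V * V] mass at least [eps ^+ 2], and there
    the cost falls short of 1 by at least one half. *)
Lemma product_cost_le {R : realType} {I : countType} (u v : I -> R)
    (V : set I) (eps : R) (F : I * I -> \bar R) :
  (forall a, 0 <= u a)%R -> (forall a, 0 <= v a)%R ->
  \esum_(a in [set: I]) (u a)%:E = 1 -> \esum_(a in [set: I]) (v a)%:E = 1 ->
  (0 <= eps)%R ->
  eps%:E <= \esum_(a in V) (u a)%:E -> eps%:E <= \esum_(a in V) (v a)%:E ->
  (forall k, 0 <= F k <= 1) -> (forall a b, V a -> V b -> F (a, b) <= 2^-1%:E) ->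
  \esum_(k in [set: I * I]) ((coupling_weight u v 0 k)%:E * F k) <=
  (1 - eps ^+ 2 / 2)%:E.
Proof.
move=> u0 v0 su sv e0 Vu Vv F01 FV.
have tuv a : (0 * u a <= v a)%R by rewrite mul0r.
have q0 k : 0 <= (coupling_weight u v 0 k)%:E :> \bar R.
  by rewrite lee_fin coupling_weight_ge0.
have qE k : coupling_weight u v 0 k = (u k.1 * v k.2)%R.
  by rewrite /coupling_weight !mul0r add0r subr0.
pose W a : \bar R := if a \in V then 1 else 0.
have W0 a : 0 <= W a by rewrite /W; case: ifP.
have F0 k : 0 <= F k by case/andP: (F01 k).
have h0 : 0 <= 2^-1%:E :> \bar R by rewrite lee_fin.
have := coupling_weight_sum u0 (lexx _) tuv su sv.
set S := \esum_(k in _) (_ * F k).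
have S0 : 0 <= S by apply: esum_ge0 => k _; rewrite mule_ge0.
move=> H; have H1 : S + \esum_(k in [set: I * I])
    ((coupling_weight u v 0 k)%:E * (2^-1%:E * (W k.1 * W k.2))) <= 1.
  rewrite -esumD; last 2 first.
  - by move=> k _; rewrite mule_ge0.
  - by move=> k _; rewrite mule_ge0// mule_ge0// mule_ge0.
  rewrite -[leRHS]H; apply: le_esum => -[a b] _.
  rewrite -ge0_muleDr//; last by rewrite mule_ge0// mule_ge0.
  rewrite -[leRHS]mule1 lee_wpmul2l//= /W.
  have /andP[_ F1] := F01 (a, b).
  case: ifPn => [/set_mem Va|_]; rewrite ?mul0e ?mule0 ?adde0//.
  case: ifPn => [/set_mem Vb|_]; rewrite ?mul0e ?mule0 ?adde0//.
  rewrite !mule1 (le_trans (leeD2r _ (FV _ _ Va Vb)))// -EFinD lee_fin.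
  lra.
have H2 : (eps ^+ 2 / 2)%:E <= \esum_(k in [set: I * I])
    ((coupling_weight u v 0 k)%:E * (2^-1%:E * (W k.1 * W k.2))).
  rewrite (eq_esum (b := fun k => 2^-1%:E * (((u k.1)%:E * W k.1) *
    ((v k.2)%:E * W k.2)))); last first.
    by move=> k _; rewrite qE EFinM muleCA; congr (_ * _); rewrite muleACA.
  have uW a : 0 <= (u a)%:E * W a by rewrite mule_ge0// lee_fin.
  have vW a : 0 <= (v a)%:E * W a by rewrite mule_ge0// lee_fin.
  rewrite esumZl//; last by move=> k; rewrite mule_ge0.
  rewrite esum_pair; last by move=> k; rewrite mule_ge0.
  rewrite /= (eq_esum (b := fun a => (\esum_(b in [set: I]) ((v b)%:E * W b)) *
    ((u a)%:E * W a))); last by move=> a _; rewrite esumZl// muleC.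
  rewrite esumZl//; last exact: esum_ge0.
  have WE (g : I -> R) : \esum_(b in [set: I]) ((g b)%:E * W b) =
      \esum_(b in V) (g b)%:E.
    rewrite [RHS]esum_mkcond; apply: eq_esum => b _; rewrite /W.
    by case: ifP; rewrite ?mule1 ?mule0.
  rewrite !WE mulrC EFinM lee_wpmul2l// expr2 EFinM.
  by apply: lee_pmul; rewrite ?lee_fin.
have := le_trans (leeD2l S H2) H1.
case: S S0 {H1} => [s| |]//= s0; rewrite -EFinD !lee_fin => ?.
by rewrite lerBrDr.
Qed.

(** * Contraction of couplings *)

Section Contraction.
Context {d : measure_display} {Omega : measurableType d} {R : realType}.
Context {P : probability Omega R} (X : rtmc P).
Variables (phi : Omega -> baire -> R) (r : R) (kap B : Omega -> R).
Hypothesis mphi :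
  measurable_fun (total_space X) (fun p : Omega * baire => phi p.1 p.2).
Hypothesis r01 : (0 < r < 1)%R.
Implicit Types (w : Omega) (x y : baire) (a : seq nat).

Local Notation th n := (iter n (theta X)).

Definition normalized_at w :=
  forall x, fiber X (theta X w) x -> ruelle X phi w (cst 1) x = 1.

Definition holder_at w := forall n x y, (2 <= n)%N -> fiber X w x ->
  fiber X w y -> (forall i, (i < n)%N -> x i = y i) ->
  (`|phi w x - phi w y| <= kap w * r ^+ n)%R.

Hypothesis kap0 : forall w, (0 <= kap w)%R.

(** After [k] shifts, two extensions by the same word of length [n] still agree on the [n - k]
    remaining letters of the word, whence the exponent. *)
Definition distortion n w : R := (\sum_(k < n) kap (th k w) * r ^+ (n - k))%R.

Lemma distortion_ge0 n w : (0 <= distortion n w)%R.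
Proof.
by apply: sumr_ge0 => i _; rewrite mulr_ge0// exprn_ge0//; case/andP: r01 => /ltW.
Qed.

Lemma birkhoff_distortion n w a x y :
  (forall k, (k < n)%N -> holder_at (th k w)) ->
  size a = n -> x 0%N = y 0%N ->
  fiber X w (scat a x) -> fiber X w (scat a y) ->
  (`|birkhoff X phi n w (scat a x) - birkhoff X phi n w (scat a y)| <=
   distortion n w * dist_seq r x y)%R.
Proof.
move=> hol sa xy wx wy; rewrite /birkhoff -sumrB mulr_suml.
apply: le_trans (ler_norm_sum _ _ _) _; apply: ler_sum => k _.
case: (dist_seqP r x y) => [->|[m [xym xmy ->]]].
  by rewrite subrr normr0 dist_seqxx// mulr0.
rewrite -mulrA -exprD; have kn := ltn_ord k.
apply: (hol k kn); [|exact: fiber_shift|exact: fiber_shift|].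
  (* [holder_at] asks for two common letters: one comes from the word since [k < n], the other is
     the shared first letter of [x] and [y]. *)
  case: m xmy {xym} => [|m] xmy; first by rewrite xy eqxx in xmy.
  by rewrite addnS ltnS addn_gt0 subn_gt0 kn.
move=> i im; rewrite !iter_shiftE /scat sa.
by have [//|nki] := ltnP (k + i) n; apply: xym; lia.
Qed.

Lemma word_weight_expR n w a x y :
  (forall k, (k < n)%N -> holder_at (th k w)) ->
  x 0%N = y 0%N -> fiber X (th n w) y ->
  (expR (- (distortion n w * dist_seq r x y)) * word_weight X phi n w a x <=
   word_weight X phi n w a y)%R.
Proof.
move=> hol xy wy; rewrite /word_weight; case: eqP => [sa|_]; last by rewrite mulr0.
have [wax|wax] := pselect (fiber X w (scat a x)); last first.
  by rewrite weight_out// mulr0 weight_ge0.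
have way : fiber X w (scat a y) by apply: (fiber_scat_first sa xy wax wy).
rewrite !weightE// -expRD ler_expR.
have := birkhoff_distortion hol sa xy wax way.
by rewrite ler_norml => /andP[_]; lra.
Qed.

(** Linearized by [1 + z <= expR z], the comparison exhibits a common proportion of the two word
    laws that is affine in the distance, ready for [coupling_weight]. *)
Lemma word_weight_distortion n w a x y :
  (forall k, (k < n)%N -> holder_at (th k w)) ->
  x 0%N = y 0%N -> fiber X (th n w) y ->
  ((1 - distortion n w * dist_seq r x y) * word_weight X phi n w a x <=
   word_weight X phi n w a y)%R.
Proof.
move=> hol xy wy; apply: le_trans (word_weight_expR a hol xy wy).
by rewrite ler_wpM2r ?word_weight_ge0// expR_ge1Dx.
Qed.

Definition Delta w x y : R := (Num.min 1 (B w * dist_seq r x y))%R.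

Lemma Delta_ge0 w x y : (0 <= B w)%R -> (0 <= Delta w x y)%R.
Proof. by move=> B0; rewrite le_min ler01 mulr_ge0// dist_seq_ge0. Qed.

Lemma measurable_Delta w :
  measurable_fun setT (fun p : baire * baire => (Delta w p.1 p.2)%:E).
Proof.
apply/measurable_EFinP; apply: measurable_minr; first exact: measurable_cst.
apply: measurable_funM; first exact: measurable_cst.
exact: measurable_dist_seq.
Qed.

(* Contraction of the Vasershtein distance of the metric [Delta]: asserting it for
   every coupling, not only for an optimal one, makes it compose. *)
Definition contracts n w (lam : R) :=
  forall m : probability (baire * baire)%type R,
  m (fiber X (th n w) `*` fiber X (th n w)) = 1 ->
  exists m' : probability (baire * baire)%type R,
  [/\ m' (fiber X w `*` fiber X w) = 1,
      forall g, measurable_fun setT g -> (forall x, 0 <= g x) ->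
        \int[m']_p g p.1 = \int[m]_p ruellen X phi n w g p.1,
      forall g, measurable_fun setT g -> (forall x, 0 <= g x) ->
        \int[m']_p g p.2 = \int[m]_p ruellen X phi n w g p.2 &
      \int[m']_p (Delta w p.1 p.2)%:E <=
        lam%:E * \int[m]_p (Delta (th n w) p.1 p.2)%:E].

(** The stretch next to the tails acts first: a coupling over [th (k + n) w] is carried to [th n w],
    and the result, which is again full on the fibres, is carried to [w]. *)
Lemma contracts_comp n k w l1 l2 : (0 <= l1)%R ->
  contracts n w l1 -> contracts k (th n w) l2 -> contracts (k + n) w (l1 * l2)%R.
Proof.
move=> l10 c1 c2 m; rewrite iterD => m1.
have [m2 [m21 fst2 snd2 D2]] := c2 m m1.
have [m3 [m31 fst3 snd3 D3]] := c1 m2 m21.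
exists m3; split=> //.
- move=> g mg g0; rewrite fst3// fst2; last 2 first.
  + exact: measurable_ruellen.
  + by move=> x; exact: ruellen_ge0.
  by rewrite ruellenD.
- move=> g mg g0; rewrite snd3// snd2; last 2 first.
  + exact: measurable_ruellen.
  + by move=> x; exact: ruellen_ge0.
  by rewrite ruellenD.
- apply: (le_trans D3); rewrite EFinM -muleA.
  by rewrite lee_wpmul2l ?lee_fin// iterD.
Qed.

Section Coupling.
Variables (n : nat) (w : Omega) (lam : R).
Hypothesis HL : forall k, (k < n)%N -> normalized_at (th k w).
Hypothesis hol : forall k, (k < n)%N -> holder_at (th k w).
Hypothesis lam01 : (0 <= lam <= 1)%R.
Hypothesis B0 : (0 <= B w)%R.
Hypothesis B1 : (1 <= B (th n w))%R.
Hypothesis Blam : (B w * r ^+ n + distortion n w <= lam * B (th n w))%R.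

Let W := word_weight X phi n w.
Let Fn := fiber X (th n w).

Let Bn0 : (0 <= B (th n w))%R. Proof. exact: le_trans B1. Qed.

Let W0 a x : (0 <= W a x)%R. Proof. exact: word_weight_ge0. Qed.

Let W1 x : Fn x -> \esum_(a in [set: seq nat]) (W a x)%:E = 1.
Proof. exact: sum_word_weight. Qed.

Let Wout a x : ~ Fn x -> W a x = 0%R.
Proof. exact: word_weight_out. Qed.

Definition close_pairs := [set p : baire * baire |
  [/\ Fn p.1, Fn p.2 & (B (th n w) * dist_seq r p.1 p.2 < 1)%R]].

Definition overlap (p : baire * baire) : R :=
  if p \in close_pairs then (1 - distortion n w * dist_seq r p.1 p.2)%R else 0%R.

(** As [B (th n w) >= 1], a scaled distance below 1 forces a distance below 1, hence equal first
    letters. As [Blam] gives [distortion n w <= B (th n w)], the proportion is nonnegative. *)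
Let closeP p : close_pairs p -> [/\ p.1 0%N = p.2 0%N, Fn p.2 &
  (0 <= 1 - distortion n w * dist_seq r p.1 p.2)%R].
Proof.
move=> [F1 F2 Bd]; have d0 := dist_seq_ge0 r01 p.1 p.2; split=> //.
  by apply: (@dist_seq_first R r); apply: le_lt_trans Bd; rewrite ler_peMl.
have /andP[l0 l1] := lam01; have D0 := distortion_ge0 n w.
have : (0 <= B w * r ^+ n)%R.
  by rewrite mulr_ge0// exprn_ge0//; case/andP: r01 => /ltW.
move=> h1; have h2 : (lam * B (th n w) <= B (th n w))%R by rewrite ler_piMl.
have h3 : (distortion n w <= B (th n w))%R.
  by apply: le_trans h2; apply: le_trans Blam; rewrite lerDr.
rewrite subr_ge0; apply: le_trans (ltW Bd); exact: ler_wpM2r.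
Qed.

Let overlap_ge0 p : (0 <= overlap p)%R.
Proof. by rewrite /overlap; case: ifPn => // /set_mem /closeP[]. Qed.

Let overlap_le1 p : (overlap p <= 1)%R.
Proof.
rewrite /overlap; case: ifPn => // _.
by rewrite lerBlDr lerDl mulr_ge0 ?distortion_ge0 ?dist_seq_ge0.
Qed.

Let overlapW p a : (overlap p * W a p.1 <= W a p.2)%R.
Proof.
rewrite /overlap; case: ifPn => [/set_mem/closeP[p12 F2 _]|_]; last by rewrite mul0r.
exact: word_weight_distortion.
Qed.

Let mclose : measurable close_pairs.
Proof.
rewrite (_ : close_pairs = (fst @^-1` Fn `&` snd @^-1` Fn) `&`
  [set p | (B (th n w) * dist_seq r p.1 p.2 < 1)%R]); last first.
  by apply/seteqP; split=> [p [? ? ?]|p [[? ?] ?]]; split.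
apply: measurableI; first apply: measurableI.
- by rewrite -[X in measurable X]setTI; apply: measurable_fst => //; exact: measurable_fiber.
- by rewrite -[X in measurable X]setTI; apply: measurable_snd => //; exact: measurable_fiber.
rewrite -[X in measurable X]setTI.
have mf : measurable_fun setT (fun p : baire * baire =>
    (B (th n w) * dist_seq r p.1 p.2 < 1)%R).
  apply: measurable_fun_ltr; last exact: measurable_cst.
  apply: measurable_funM; first exact: measurable_cst.
  exact: measurable_dist_seq.
exact: (mf measurableT [set true]).
Qed.

Let moverlap : measurable_fun setT overlap.
Proof.
apply: measurable_fun_ifT.
- apply: (measurable_fun_bool true); rewrite setTI.
  rewrite (_ : _ @^-1` _ = close_pairs)//.
  by apply/seteqP; split=> p /=; [move/set_mem|move/mem_set].
- apply: measurable_funB; first exact: measurable_cst.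
  apply: measurable_funM; first exact: measurable_cst.
  exact: measurable_dist_seq.
- exact: measurable_cst.
Qed.

Let q (k : seq nat * seq nat) (p : baire * baire) : R :=
  coupling_weight (W^~ p.1) (W^~ p.2) (overlap p) k.

Let h (k : seq nat * seq nat) (p : baire * baire) : baire * baire :=
  (scat k.1 p.1, scat k.2 p.2).

Let q0 k p : (0 <= q k p)%R.
Proof. by apply: coupling_weight_ge0. Qed.

Let mW1 a : measurable_fun setT (fun p : baire * baire => W a p.1).
Proof.
by apply: (measurableT_comp (f := W a)) measurable_fst; exact: measurable_word_weight.
Qed.

Let mW2 a : measurable_fun setT (fun p : baire * baire => W a p.2).
Proof.
by apply: (measurableT_comp (f := W a)) measurable_snd; exact: measurable_word_weight.
Qed.

Let mq k : measurable_fun setT (q k).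
Proof.
apply: measurable_funD.
  apply: measurable_funM; last exact: measurable_cst.
  exact: measurable_funM.
apply: measurable_funM => //; apply: measurable_funB => //.
exact: measurable_funM.
Qed.

Let mh k : measurable_fun setT (h k).
Proof.
apply: measurable_fun_pair.
  exact: (measurableT_comp (measurable_scat k.1) measurable_fst).
exact: (measurableT_comp (measurable_scat k.2) measurable_snd).
Qed.

Let q_out p k : ~ (Fn `*` Fn) p -> q k p = 0%R.
Proof.
move=> nF; have o0 : overlap p = 0%R.
  by rewrite /overlap memNset// => -[F1 F2 _]; apply: nF.
rewrite /q /coupling_weight o0 !mul0r add0r subr0.
have [F1|F1] := pselect (Fn p.1); last by rewrite Wout// mul0r.
have [F2|F2] := pselect (Fn p.2); last by rewrite [X in (_ * X)%R]Wout// mulr0.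
by case: nF.
Qed.

Let q_sum p : \esum_(k in [set: seq nat * seq nat]) (q k p)%:E =
  (\1_(Fn `*` Fn) p)%:E.
Proof.
rewrite indicE; have [[F1 F2]|nF] := pselect ((Fn `*` Fn) p).
  rewrite mem_set//; apply: coupling_weight_sum => //; exact: W1.
by rewrite memNset// esum1// => k _; rewrite q_out.
Qed.

(** The delicate case is an inadmissible second word: its weight over [p.2] is 0, and [overlapW]
    then forces the subtracted term [overlap p * W k.2 p.1] to vanish as well. *)
Let fiber_q k p : q k p != 0%R -> (fiber X w `*` fiber X w) (h k p).
Proof.
have Wf a x : ~ fiber X w (scat a x) -> W a x = 0%R.
  by move=> nw; rewrite /W /word_weight; case: eqP => // _; rewrite weight_out.
have [f1|f1] := pselect (fiber X w (scat k.1 p.1)); last first.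
  by rewrite /q /coupling_weight Wf// !(mulr0,mul0r) addr0 eqxx.
have [f2|f2] := pselect (fiber X w (scat k.2 p.2)); first by [].
have W2 := Wf _ _ f2.
have oW : (overlap p * W k.2 p.1 = 0)%R.
  apply/eqP; rewrite eq_le mulr_ge0// andbT; apply: le_trans (overlapW p k.2) _.
  by rewrite W2.
rewrite /q /coupling_weight W2 sub0r oW oppr0 mulr0 addr0.
have [->|_] := eqVneq k.1 k.2; last by rewrite mulr0 eqxx.
by rewrite oW mul0r eqxx.
Qed.

Let mF : measurable (Fn `*` Fn : set (baire * baire)).
Proof. by apply: measurableX; exact: measurable_fiber. Qed.

(* Far pairs are coupled independently, which is the only place where the block
   hypothesis enters; close pairs keep a common word as often as possible. *)
Hypothesis far : forall p, (Fn `*` Fn) p -> (1 <= B (th n w) * dist_seq r p.1 p.2)%R ->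
  \esum_(k in [set: seq nat * seq nat])
    ((coupling_weight (W^~ p.1) (W^~ p.2) 0 k)%:E *
     (Delta w (scat k.1 p.1) (scat k.2 p.2))%:E) <= lam%:E.

(** For a close pair at distance [d], the same word is drawn for both with probability [1 - D * d],
    leaving cost at most [B w * r ^+ n * d]; otherwise the cost is at most 1. [Blam] bounds the sum
    of the two contributions. *)
Let cost_le p : \esum_(k in [set: seq nat * seq nat])
    ((q k p)%:E * (Delta w (h k p).1 (h k p).2)%:E) <=
  lam%:E * (Delta (th n w) p.1 p.2)%:E.
Proof.
have /andP[l0 l1] := lam01.
have [FF|nF] := pselect ((Fn `*` Fn) p); last first.
  rewrite esum1; first by rewrite mule_ge0 ?lee_fin ?Delta_ge0.
  by move=> k _; rewrite q_out// mul0e.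
have [F1 F2] := FF.
have [Bd|Bd] := ltP (B (th n w) * dist_seq r p.1 p.2)%R 1%R; last first.
  rewrite /Delta min_l// mule1; apply: le_trans (far FF Bd).
  apply: le_esum => k _; rewrite /q (_ : overlap p = 0%R)//.
  by rewrite /overlap memNset// => -[_ _]; rewrite ltNge Bd.
have cp : close_pairs p by [].
have [p12 _ D1] := closeP cp.
have d0 := dist_seq_ge0 r01 p.1 p.2.
have rn0 : (0 <= r ^+ n)%R by rewrite exprn_ge0//; case/andP: r01 => /ltW.
(* Setting the cost to 0 on words of the wrong length changes nothing in the sum and makes the
   diagonal bound of [coupling_cost_le] true for all words. *)
pose F (k : seq nat * seq nat) : \bar R :=
  if (size k.1 == n) && (size k.2 == n) then (Delta w (scat k.1 p.1) (scat k.2 p.2))%:E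
  else 0.
rewrite (eq_esum (b := fun k => (q k p)%:E * F k)); last first.
  move=> k _; rewrite /F /h/=; case: ifPn => //; rewrite negb_and /q /coupling_weight.
  case/orP => [k1|k2].
    by rewrite (_ : W k.1 p.1 = 0%R) ?(mulr0, mul0r, add0r, mul0e, mule0)//
      /W /word_weight (negbTE k1).
  have z x : W k.2 x = 0%R by rewrite /W /word_weight (negbTE k2).
  rewrite !z mulr0 subrr mulr0 addr0 mule0.
  by case: eqP => [->|_]; rewrite ?z ?mulr0 ?mul0r mul0e.
apply: (@le_trans _ _ (overlap p * (B w * r ^+ n * dist_seq r p.1 p.2) +
    (1 - overlap p))%:E).
  apply: coupling_cost_le => //; [exact: W1|exact: W1| | |].
  - move=> k; rewrite /F; case: ifP => _; last by rewrite lexx lee_fin ler01.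
    by rewrite !lee_fin Delta_ge0//= ge_min lexx.
  - by rewrite !mulr_ge0.
  - move=> a; rewrite /F; case: ifPn => [/andP[/= /eqP sa _]|_]; last first.
      by rewrite lee_fin !mulr_ge0.
    by rewrite lee_fin ge_min dist_seq_scat// sa mulrA lexx orbT.
rewrite /Delta min_r; last exact: ltW.
rewrite -EFinM lee_fin /overlap mem_set//.
have := distortion_ge0 n w.
set D := distortion n w in D1 *; set dd := dist_seq _ _ _ in d0 D1 *.
move=> D0; have : (0 <= B w * r ^+ n)%R by rewrite mulr_ge0.
move: Blam; rewrite -/D; set b := (B w * _)%R; set b' := B _.
(* The cost is [(1 - D * dd) * (b * dd) + D * dd]; the negative cross term is dropped, and [H] is
   multiplied by [dd]. *)
move=> H b0; apply: (@le_trans _ _ (b * dd + D * dd)%R); last by nra.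
have : (0 <= D * dd)%R by rewrite mulr_ge0.
have : (0 <= b * dd)%R by rewrite mulr_ge0.
by nra.
Qed.

(** For each pair of tails the two word laws are coupled by [q], and these couplings are integrated
    against [m]. The marginal identities are established where both tails lie in the fibre, that is,
    [m]-almost everywhere. *)
Lemma contracts_coupling : contracts n w lam.
Proof.
move=> m m1.
have q1 p : \esum_(k in [set: seq nat * seq nat]) (q k p)%:E <= 1.
  by rewrite q_sum lee_fin indicE lern1 leq_b1.
have qm : \int[m]_p (\esum_(k in [set: seq nat * seq nat]) (q k p)%:E) = 1.
  under eq_integral do rewrite q_sum.
  by rewrite integral_indic// setIT.
have [m' m'E] := mixture_probability q0 mq mh q1 qm.
have aeF : {ae m, forall p, (Fn `*` Fn) p}.
  exists (~` (Fn `*` Fn)); split=> //; first exact: measurableC.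
  by rewrite probability_setC// m1 subee.
exists m'; split.
- have mFw : measurable (fiber X w `*` fiber X w : set (baire * baire)).
    by apply: measurableX; exact: measurable_fiber.
  have mI : measurable_fun setT (fun y : baire * baire =>
      (\1_(fiber X w `*` fiber X w) y)%:E : \bar R).
    by apply/measurable_EFinP; exact: measurable_indic.
  rewrite -[X in m' X]setIT -integral_indic// (m'E _ mI)//.
  rewrite -[RHS]qm; apply: eq_integral => p _; apply: eq_esum => k _.
  have [->|/fiber_q wk] := eqVneq (q k p) 0%R; first by rewrite mul0e.
  by rewrite indicE mem_set// mule1.
- move=> g mg g0; rewrite (m'E (fun p => g p.1))//; last first.
    exact: (measurableT_comp mg measurable_fst).
  apply: ge0_ae_eq_integral => //.
  + apply: measurable_esum => [k|k p]; last by rewrite mule_ge0 ?lee_fin.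
    apply: emeasurable_funM; first exact/measurable_EFinP.
    exact: (measurableT_comp mg (measurableT_comp measurable_fst (mh k))).
  + apply: (measurableT_comp (f := ruellen X phi n w g)) measurable_fst.
    exact: measurable_ruellen.
  + by move=> p _; apply: esum_ge0 => k _; rewrite mule_ge0 ?lee_fin.
  + by move=> p _; exact: ruellen_ge0.
  apply: filterS aeF => p [F1 F2] _; rewrite ruellenE//.
  apply: (coupling_weight_fst _ _ _ _ _ (g := fun a => g (scat a p.1))) => //.
  * exact: W1.
  * exact: W1.
- move=> g mg g0; rewrite (m'E (fun p => g p.2))//; last first.
    exact: (measurableT_comp mg measurable_snd).
  apply: ge0_ae_eq_integral => //.
  + apply: measurable_esum => [k|k p]; last by rewrite mule_ge0 ?lee_fin.
    apply: emeasurable_funM; first exact/measurable_EFinP.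
    exact: (measurableT_comp mg (measurableT_comp measurable_snd (mh k))).
  + apply: (measurableT_comp (f := ruellen X phi n w g)) measurable_snd.
    exact: measurable_ruellen.
  + by move=> p _; apply: esum_ge0 => k _; rewrite mule_ge0 ?lee_fin.
  + by move=> p _; exact: ruellen_ge0.
  apply: filterS aeF => p [F1 F2] _; rewrite ruellenE//.
  apply: (coupling_weight_snd _ _ _ _ (g := fun a => g (scat a p.2))) => //.
  exact: W1.
- rewrite m'E//; last 2 first.
  + exact: measurable_Delta.
  + by move=> p; rewrite lee_fin Delta_ge0.
  have /andP[l0 l1] := lam01.
  rewrite -ge0_integralZl_EFin//; last 2 first.
  + by move=> p _; rewrite lee_fin Delta_ge0.
  + exact: measurable_Delta.
  apply: ge0_le_integral => //.
  + by move=> p _; apply: esum_ge0 => k _; rewrite mule_ge0 ?lee_fin ?Delta_ge0.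
  + apply: measurable_esum => [k|k p]; last by rewrite mule_ge0 ?lee_fin ?Delta_ge0.
    apply: emeasurable_funM; first exact/measurable_EFinP.
    exact: (measurableT_comp (measurable_Delta w) (mh k)).
  + by apply: measurable_funeM; exact: measurable_Delta.
Qed.

End Coupling.

End Contraction.

(** * From couplings to the Vasershtein distance *)

Section SetFunctionIntegral.
Import HBNNSimple.

(** A random probability is a mere set function that agrees with a measure on measurable sets.
    Integrals of simple functions see only such sets, so measure theory becomes available. *)
Lemma eq_setfun_integral {d} {T : measurableType d} {R : realType}
    (M : set T -> \bar R) (m : {measure set T -> \bar R}) (f : T -> \bar R) :
  (forall A, measurable A -> M A = m A) -> \int[M]_x f x = \int[m]_x f x.
Proof.
move=> Mm; have sE (h : {nnsfun T >-> R}) : sintegral M h = sintegral m h.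
  by apply: eq_fsbigr => x _; rewrite Mm.
rewrite /integral/=; congr (_ - _); congr ereal_sup;
  by apply/seteqP; split=> _ [h hf <-]; exists h; rewrite // sE.
Qed.

End SetFunctionIntegral.

(** Every point outside the support lies in a null cylinder by [open_bcyl], and there are countably
    many cylinders. *)
Lemma msupport_full {R : realType} (m : probability baire R) :
  measurable (msupport m) -> m (msupport m) = 1.
Proof.
move=> mS; pose F i : set baire :=
  if unpickle i is Some a then
    [set x | m (bcyl a) = 0 /\ bcyl a x] else set0.
have F0 i : m.-negligible (F i).
  rewrite /F; case: unpickle => [a|]; last exact: negligible_set0.
  have [ma|ma] := pselect (m (bcyl a) = 0).
    exists (bcyl a); split=> //; [exact: measurable_bcyl|by move=> x []].
  apply: negligibleS (negligible_set0 m) => x. by move=> [/ma].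
have : m.-negligible (~` msupport m).
  apply: negligibleS (negligible_bigcup F0) => x /existsNP[U].
  move=> /not_implyP[oU] /not_implyP[Ux /negP]; rewrite -leNgt => U0.
  have [n nU] := open_bcyl oU Ux; exists (pickle (mkseq x n)) => //.
  rewrite /F pickleK; split; last exact/bcyl_mkseq.
  apply/eqP; rewrite eq_le measure_ge0 andbT; apply: le_trans U0.
  apply: le_measure => //; rewrite inE; first exact: measurable_bcyl.
  exact: sub_sigma_algebra.
rewrite negligibleP; last exact: measurableC.
move=> /(etrans (esym (probability_setC m mS))).
have := fin_num_measure m _ mS; move: (m _) => [x| |]//= _.
by rewrite -EFinB => -[/eqP]; rewrite subr_eq0 => /eqP <-.
Qed.

Section Vasershtein_contraction.
Context {d : measure_display} {Omega : measurableType d} {R : realType}.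
Context {P : probability Omega R} (X : rtmc P).
Variables (phi : Omega -> baire -> R) (r : R) (B : Omega -> R).
Hypothesis mphi :
  measurable_fun (total_space X) (fun p : Omega * baire => phi p.1 p.2).
Hypothesis r01 : (0 < r < 1)%R.

Local Notation th n := (iter n (theta X)).

Definition probability_on_fiber w (M : set baire -> \bar R) :=
  (exists m : probability baire R, forall A, measurable A -> M A = m A) /\
  msupport M = fiber X w.

Lemma probability_on_fiber_full w M : probability_on_fiber w M ->
  M (fiber X w) = 1.
Proof.
move=> [[m Mm] Mw]; rewrite Mm; last exact: measurable_fiber.
have mw : msupport m = fiber X w.
  rewrite -Mw; apply/seteqP; split=> x xU U oU Ux; have := xU U oU Ux;
    by rewrite (Mm U)//; exact: sub_sigma_algebra.
by rewrite -mw msupport_full// mw; exact: measurable_fiber.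
Qed.

Lemma coupling_fibers w M1 M2 m :
  probability_on_fiber w M1 -> probability_on_fiber w M2 ->
  coupling M1 M2 m -> m (fiber X w `*` fiber X w) = 1.
Proof.
move=> p1 p2 cm; have mF : measurable (fiber X w) by exact: measurable_fiber.
have mX1 : measurable (fiber X w `*` setT : set (baire * baire)).
  by apply: measurableX.
have mX2 : measurable (setT `*` fiber X w : set (baire * baire)).
  by apply: measurableX.
have [m1 m2] := cm _ mF.
have e1 : m (~` (fiber X w `*` setT)) = 0.
  by rewrite probability_setC// m1 (probability_on_fiber_full p1) subee.
have e2 : m (~` (setT `*` fiber X w)) = 0.
  by rewrite probability_setC// m2 (probability_on_fiber_full p2) subee.
have e : m (~` (fiber X w `*` setT) `|` ~` (setT `*` fiber X w)) = 0.
  rewrite measureU0 ?e1//; exact: (measurableC).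
rewrite (_ : _ `*` _ = ~` (~` (fiber X w `*` setT) `|` ~` (setT `*` fiber X w))).
  rewrite probability_setC ?e ?sube0//.
  by apply: measurableU; [exact: (measurableC mX1)|exact: (measurableC mX2)].
by rewrite setCU !setCK; apply/seteqP; split=> [p []|p [[] ? _ [_ ?]]].
Qed.

(** [B w >= 1] and [dist_seq <= 1] give [dist_seq <= Delta] at [w], while [Delta] at [th n w] is at
    most [B (th n w)] times the distance. The bound of [contracts], valid for each coupling of [M1]
    and [M2], passes to the infimum. *)
Lemma contracts_vasershtein n w lam M1 M2 : (0 < lam)%R ->
  (1 <= B w)%R -> (0 < B (th n w))%R ->
  contracts X phi r B n w lam ->
  probability_on_fiber (th n w) M1 -> probability_on_fiber (th n w) M2 ->
  vasershtein r (dual_ruellen X phi n w M1) (dual_ruellen X phi n w M2) <=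
  (lam * B (th n w))%:E * vasershtein r M1 M2.
Proof.
move=> l0 Bw Bn0 con p1 p2.
have lB0 : (0 < lam * B (th n w))%R by rewrite mulr_gt0.
rewrite -lee_pdivrMl//; apply: le_ereal_inf_tmp => _ [m cm <-].
rewrite lee_pdivrMl//.
have [m' [_ fst' snd' D']] := con m (coupling_fibers p1 p2 cm).
have marg (i : baire * baire -> baire) M (g : baire -> \bar R) :
    measurable_fun setT i -> (exists m0 : probability baire R,
      forall A, measurable A -> M A = m0 A) ->
    (forall A, measurable A -> m (i @^-1` A) = M A) ->
    measurable_fun setT g -> (forall x, 0 <= g x) ->
    \int[m]_p g (i p) = \int[M]_x g x.
  move=> mi [m0 Mm0] miM mg g0; rewrite (eq_setfun_integral _ Mm0).
  rewrite -[LHS](@ge0_integral_pushforward _ _ _ _ _ _ mi m setT g)//.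
  by apply: eq_measure_integral => A mA _; exact: etrans (miM A mA) (Mm0 A mA).
apply: (@le_trans _ _ (\int[m']_p (dist_seq r p.1 p.2)%:E)).
  apply: ereal_inf_lbound; exists m' => // A mA.
  have mI : measurable_fun setT (fun y : baire => (\1_A y)%:E : \bar R).
    by apply/measurable_EFinP; exact: measurable_indic.
  have I0 (y : baire) : 0 <= (\1_A y)%:E :> \bar R by rewrite lee_fin.
  split.
  - rewrite -[X in m' X]setIT -integral_indic//; last exact: measurableX.
    rewrite (_ : \int[m']_p _ = \int[m']_p (\1_A p.1)%:E); last first.
      by apply: eq_integral => p _; rewrite !indicE in_setX in_setT andbT.
    rewrite (fst' _ mI I0) /dual_ruellen.
    apply: (marg fst M1) => //; first by have [] := p1.
    + move=> A' mA'; have [<- _] := cm _ mA'; congr (m _).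
      by apply/seteqP; split=> [p|p []].
    + exact: measurable_ruellen.
    + by move=> x; exact: ruellen_ge0.
  - rewrite -[X in m' X]setIT -integral_indic//; last exact: measurableX.
    rewrite (_ : \int[m']_p _ = \int[m']_p (\1_A p.2)%:E); last first.
      by apply: eq_integral => p _; rewrite !indicE in_setX in_setT.
    rewrite (snd' _ mI I0) /dual_ruellen.
    apply: (marg snd M2) => //; first by have [] := p2.
    + move=> A' mA'; have [_ <-] := cm _ mA'; congr (m _).
      by apply/seteqP; split=> [p|p []].
    + exact: measurable_ruellen.
    + by move=> x; exact: ruellen_ge0.
have md : measurable_fun setT (fun p : baire * baire => (dist_seq r p.1 p.2)%:E).
  by apply/measurable_EFinP; exact: measurable_dist_seq.
apply: (@le_trans _ _ (\int[m']_p (Delta r B w p.1 p.2)%:E)).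
  apply: ge0_le_integral => //.
  - by move=> p _; rewrite lee_fin dist_seq_ge0.
  - exact: measurable_Delta.
  - move=> p _; rewrite lee_fin le_min dist_seq_le1//= ler_peMl//.
    exact: dist_seq_ge0.
apply: (le_trans D'); rewrite EFinM -muleA lee_wpmul2l ?lee_fin ?(ltW l0)//.
rewrite -ge0_integralZl_EFin//; last 2 first.
- by move=> p _; rewrite lee_fin dist_seq_ge0.
- exact: ltW.
apply: ge0_le_integral => //.
- by move=> p _; rewrite lee_fin Delta_ge0// ltW.
- exact: measurable_Delta.
- exact: measurable_funeM.
- by move=> p _; rewrite -EFinM lee_fin ge_min lexx orbT.
Qed.

End Vasershtein_contraction.

(** * Measurable paths in the fibres *)

Lemma finite_min {R : realType} (I : set nat) (Q : nat -> R -> Prop) :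
  finite_set I -> (forall b e e', (e' <= e)%R -> Q b e -> Q b e') ->
  (forall b, I b -> exists2 e, (0 < e)%R & Q b e) ->
  exists2 e, (0 < e)%R & forall b, I b -> Q b e.
Proof.
move=> fI mono H.
have [n In] : exists n, forall b, I b -> (b < n)%N.
  have /finite_seqP[s Is] := fI.
  exists (\max_(b <- s) b).+1 => b; rewrite Is /= ltnS => bs.
  exact: leq_bigmax_seq.
suff [e e0 eQ] : exists2 e, (0 < e)%R & forall b, (b < n)%N -> I b -> Q b e.
  by exists e => // b Ib; apply: eQ => //; exact: In.
elim: n {In} => [|n [e e0 IH]]; first by exists 1%R.
have [In|nIn] := pselect (I n); last first.
  exists e => // b; rewrite ltnS leq_eqVlt => /orP[/eqP -> //|]; exact: IH.
have [e' e'0 Qn] := H n In; exists (Num.min e e'); first by rewrite lt_min e0.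
move=> b; rewrite ltnS leq_eqVlt => /orP[/eqP -> _|bn Ib].
  by apply: mono Qn; rewrite ge_min lexx orbT.
by apply: mono (IH b bn Ib); rewrite ge_min lexx.
Qed.

Lemma finite_max (I : set nat) (f : nat -> nat) :
  finite_set I -> exists n, forall b, I b -> (f b <= n)%N.
Proof.
move=> /finite_seqP[s Is]; exists (\max_(b <- s) f b)%N => b; rewrite Is /= => bs.
exact: leq_bigmax_seq.
Qed.

Section GreedyPath.
Context {d : measure_display} {Omega : measurableType d} {R : realType}.
Context {P : probability Omega R} (X : rtmc P).
Implicit Types (w : Omega) (x y : baire) (a : seq nat).

Local Notation th n := (iter n (theta X)).

Lemma theta_iterV n w : thetaV X (th n.+1 w) = th n w.
Proof. by rewrite iterS thetaK. Qed.

(** The letter [e] closes the word and opens [y], so the transition at the junction is already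
    checked in [words]. *)
Lemma words_scat m w u e y : size u = m -> words X m.+1 w (rcons u e) ->
  fiber X (th m w) y -> y 0%N = e -> fiber X w (scat u y).
Proof.
move=> um [_ lu au] wy y0 i; rewrite /scat um.
have [im|mi1] := ltnP i.+1 m.
  have i1 : (i < m.+1)%N by rewrite ltnW// ltnW.
  have := lu i i1; have := lu i.+1 (ltnW im); have := au i (ltnW im).
  by rewrite !nth_rcons um im (ltnW im) => ? ? ?; split.
have [im|mi] := ltnP i m.
  have mE : m = i.+1 by apply/eqP; rewrite eqn_leq im mi1.
  have := lu i (ltnW im); have := lu i.+1 im; have := au i im.
  by rewrite mE subnn y0 !nth_rcons um mE ltnSn ltnn eqxx => ? ? ?; split.
by have := wy (i - m)%N; rewrite -!iterD -subSn// !subnK// leqW.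
Qed.

Definition allowed i j : set Omega :=
  [set w | [/\ letters X w i, letters X (theta X w) j & alpha X w i j]].

Definition successor w i : nat :=
  if pselect (exists j, w \in allowed i j) is left e then ex_minn e else 0%N.

Lemma successorP w i j : allowed i j w -> allowed i (successor w i) w.
Proof.
move=> wij; rewrite /successor; case: pselect => [e|[]]; last first.
  by exists j; exact: mem_set.
by case: ex_minnP => k /set_mem.
Qed.

Lemma measurable_successor i j : measurable [set w | successor w i = j].
Proof.
have mS k : measurable (allowed i k) by exact: alpha_measurable.
rewrite (_ : mkset _ =
  (allowed i j `&` \bigcap_(k in [set k | (k < j)%N]) ~` allowed i k) `|`
  ([set _ | j = 0%N] `&` \bigcap_k ~` allowed i k)).
  apply: measurableU; apply: measurableI => //.
  - by apply: bigcap_measurableType => k _; exact: measurableC.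
  - exact: measurable_cst_set.
  - by apply: bigcap_measurableType => k _; exact: measurableC.
apply/seteqP; split=> w /=.
  rewrite /successor; case: pselect => [e|ne <-]; last first.
    by right; split=> // k _ wk; apply: ne; exists k; exact: mem_set.
  case: ex_minnP => k /set_mem wk kmin <-; left; split=> // l lk /mem_set /kmin.
  by rewrite leqNgt lk.
rewrite /successor; case: pselect => [e|ne].
  case: ex_minnP => k /set_mem wk kmin [[wj jmin]|[_ no]]; last by case: (no k I).
  apply/eqP; rewrite eqn_leq kmin ?mem_set//= leqNgt; apply/negP => kj.
  exact: (jmin k kj).
by case=> [[wj _]|[-> //]]; case: ne; exists j; exact: mem_set.
Qed.

(* Always taking the least admissible next letter makes the path a measurable
   function of [w]. *)
Fixpoint greedy_at c w i : nat :=
  if i is k.+1 then successor (th k w) (greedy_at c w k) else c.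

Definition greedy c w : baire := greedy_at c w.

Lemma measurable_greedy c : measurable_fun setT (greedy c).
Proof.
apply: measurable_fun_baire => i; elim: i => [|i IH] j.
  exact: (@measurable_cst_set _ Omega (c = j)).
rewrite (_ : mkset _ = \bigcup_k ([set w | greedy c w i = k] `&`
    th i @^-1` [set w | successor w k = j])).
  apply: bigcupT_measurable => k; apply: measurableI => //.
  rewrite -[X in measurable X]setTI.
  exact: (measurable_iter (theta_measurable X) i measurableT
    (measurable_successor k j)).
apply/seteqP; split=> [w /= H|w [k _ [/= <- ]]//].
by exists (greedy c w i).
Qed.

Definition has_successors w :=
  forall i, letters X w i -> exists j, allowed i j w.

Lemma greedy_fiber c w : (forall n, has_successors (th n w)) -> letters X w c ->
  fiber X w (greedy c w).
Proof.
move=> suc wc.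
have H i : allowed (greedy c w i) (greedy c w i.+1) (th i w).
  elim: i => [|i [_ l _]].
    have [j wcj] := suc 0%N c wc; exact: (successorP wcj).
  have [j wj] := suc i.+1 _ l; exact: (successorP wj).
by move=> i; have [] := H i.
Qed.

Lemma ae_has_successors : {ae P, forall w, has_successors w}.
Proof.
apply: filterS (row_col_pos X) => w H i wi; have [H1 _] := H i wi.
apply: contrapT => /forallNP nj; move: H1.
rewrite esum1 ?ltxx// => j lj.
by case: (boolP (alpha X w i j)) => // wij; case: (nj j).
Qed.

End GreedyPath.

(** * The distortion constant of the past *)

Lemma geometric_sum_le {R : realFieldType} (x : R) n : (0 <= x < 1)%R ->
  (\sum_(i < n) x ^+ i.+1 <= (1 - x)^-1)%R.
Proof.
move=> /andP[x0 x1]; have h : (0 < 1 - x)%R by rewrite subr_gt0.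
rewrite -[leRHS]mul1r ler_pdivlMr//.
rewrite (eq_bigr (fun i : 'I_n => x * x ^+ i)%R); last by move=> i _; rewrite exprS.
rewrite -mulr_sumr mulrAC.
have H : ((1 - x) * \sum_(i < n) x ^+ i = 1 - x ^+ n)%R.
  by rewrite -[RHS]opprB subrX1 -mulNr opprB.
have -> : (x * (1 - x) * \sum_(i < n) x ^+ i = x * (1 - x ^+ n))%R.
  by rewrite -mulrA H.
have : (0 <= x ^+ n)%R by rewrite exprn_ge0.
by nra.
Qed.

Section DistortionConstant.
Context {d : measure_display} {Omega : measurableType d} {R : realType}.
Context {P : probability Omega R} (X : rtmc P).
Variables (u : R) (kappa : Omega -> R).
Hypothesis u01 : (0 < u < 1)%R.
Hypothesis mkappa : measurable_fun setT kappa.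
Hypothesis kappa0 : forall w, (0 <= kappa w)%R.
Hypothesis ikappa : \int[P]_w ((fun v => lne (kappa v)%:E)^\+ w) < +oo.

Local Notation th n := (iter n (theta X)).
Local Notation thV n := (iter n (thetaV X)).
Local Notation t := (u ^+ 2)%R.

Let u0 : (0 < u)%R. Proof. by case/andP: u01. Qed.
Let u1 : (u < 1)%R. Proof. by case/andP: u01. Qed.
Let t0 : (0 < t)%R. Proof. by rewrite exprn_gt0. Qed.
Let t1 : (t < 1)%R. Proof. by rewrite expr_lt1// ltW. Qed.

(** The added [t^-1] contributes 1 to the first term of [past_sum], whence [past >= 1], and leaves
    [kap] an upper bound of [kappa]. *)
Definition kap w : R := (kappa w + t^-1)%R.

Lemma kap_ge0 w : (0 <= kap w)%R.
Proof. by rewrite addr_ge0// invr_ge0 ltW. Qed.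

Lemma thetaV_preserving A : measurable A -> P (thetaV X @^-1` A) = P A.
Proof.
move=> mA; rewrite -(theta_preserving X); last first.
  by rewrite -[X in measurable X]setTI; exact: (thetaV_measurable X).
by congr (P _); apply/seteqP; split=> w /=; rewrite thetaK.
Qed.

Lemma kap_growth (T : Omega -> Omega) (s : R) : measurable_fun setT T ->
  (forall A, measurable A -> P (T @^-1` A) = P A) -> (0 < s < 1)%R ->
  {ae P, forall w, exists2 K, (0 <= K)%R &
    forall n, (kap (iter n T w) * s ^+ n <= K)%R}.
Proof.
move=> mT PT s01; apply: filterS (orbit_growth mT PT mkappa kappa0 ikappa s01).
move=> w [K KH]; have s0 : (0 <= s)%R by case/andP: s01 => /ltW.
exists (K + t^-1)%R.
  apply: addr_ge0; last by rewrite invr_ge0 ltW.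
  by apply: le_trans (KH 0%N); rewrite mulr_ge0.
move=> n; rewrite mulrDl lerD// ler_piMr ?invr_ge0 ?(ltW t0)//.
by rewrite exprn_ile1//; case/andP: s01 => _ /ltW.
Qed.

(* The solution of [past (theta w) = t * (kap w + past w)]; see [pastS]. *)
Definition past_sum w : \bar R := \sum_(j <oo) (kap (thV j.+1 w) * t ^+ j.+1)%:E.

Definition past w : R := fine (past_sum w).

Let term_ge0 w j : 0 <= (kap (thV j.+1 w) * t ^+ j.+1)%:E :> \bar R.
Proof. by rewrite lee_fin mulr_ge0 ?kap_ge0// exprn_ge0// ltW. Qed.

Let mkap : measurable_fun setT kap.
Proof. by apply: measurable_funD => //; exact: measurable_cst. Qed.

Lemma measurable_past : measurable_fun setT past.
Proof.
apply: measurableT_comp; first exact: fine_measurable.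
apply: ge0_emeasurable_sum => // j _; apply/measurable_EFinP.
apply: measurable_funM; last exact: measurable_cst.
exact: (measurableT_comp mkap (measurable_iter (thetaV_measurable X) j.+1)).
Qed.

Lemma past_ge0 w : (0 <= past w)%R.
Proof. by rewrite fine_ge0// nneseries_ge0. Qed.

Lemma past_sum_theta w :
  past_sum (theta X w) = (t * kap w)%:E + t%:E * past_sum w.
Proof.
rewrite /past_sum nneseries_recl// -nneseriesZl; last by move=> j _.
congr (_ + _); first by rewrite /= thetaK expr1 mulrC.
rewrite -nneseries_addn//; apply: eq_eseriesr => j _.
rewrite addn1 -EFinM [iter j.+2 _ _]iterSr thetaK.
by congr EFin; rewrite [(t ^+ j.+2)%R]exprS mulrCA.
Qed.

(** Here [t = u ^ 2] is used: one factor [u ^ j] absorbs the growth of [kap] along the backward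
    orbit, the other makes the series geometric. *)
Lemma ae_past_sum : {ae P, forall w, past_sum w < +oo}.
Proof.
apply: filterS (kap_growth (thetaV_measurable X) thetaV_preserving u01).
move=> w [K K0 KH]; apply: (@le_lt_trans _ _ (K * (1 - u)^-1)%:E); last exact: ltry.
apply: lime_le; first exact: is_cvg_nneseries.
apply: nearW => n; rewrite big_mkord sumEFin lee_fin.
apply: (@le_trans _ _ (\sum_(i < n) K * u ^+ i.+1)%R).
  apply: ler_sum => i _; rewrite -exprM mulnC exprM expr2 mulrA.
  by rewrite ler_wpM2r// exprn_ge0// ltW.
rewrite -mulr_sumr ler_wpM2l// geometric_sum_le//. 
by rewrite u1 andbT ltW.
Qed.

Definition past_finite w := forall n, past_sum (th n w) < +oo.

Lemma pastS w n : past_finite w ->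
  past (th n.+1 w) = (t * (kap (th n w) + past (th n w)))%R.
Proof.
move=> fin; have fn : past_sum (th n w) \is a fin_num.
  by rewrite ge0_fin_numE// nneseries_ge0.
rewrite /past iterS past_sum_theta fineD// ?fineM//; last by rewrite fin_numM.
by rewrite /= [RHS]mulrDr.
Qed.

Lemma past_ge1 w n : past_finite w -> (1 <= past (th n w))%R.
Proof.
move=> fin; have fn : past_sum (th n w) \is a fin_num.
  by rewrite ge0_fin_numE// nneseries_ge0.
rewrite -lee_fin fineK// /past_sum nneseries_recl//.
apply: (@le_trans _ _ ((kap (thV 1 (th n w)) * t ^+ 1)%:E)); last first.
  by rewrite leeDl// nneseries_ge0.
by rewrite lee_fin expr1 /kap mulrDl mulVf ?gt_eqF// lerDr mulr_ge0// ltW.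
Qed.

Lemma past_iter w n : past_finite w ->
  past (th n w) = (t ^+ n * past w + \sum_(k < n) kap (th k w) * t ^+ (n - k))%R.
Proof.
move=> fin; elim: n => [|n IH]; first by rewrite big_ord0 expr0 mul1r addr0.
rewrite pastS// IH big_ord_recr/= subSn// subnn expr1 [(t ^+ n.+1)%R]exprS.
rewrite [in RHS](eq_bigr (fun k : 'I_n => t * (kap (th k w) * t ^+ (n - k)))%R); last first.
  by move=> k _; rewrite subSn ?(ltnW (ltn_ord k))// [(t ^+ _.+1)%R]exprS mulrCA.
by rewrite -mulr_sumr; move: (kap _) (past _) (\sum_(i < n) _)%R (t ^+ n)%R; move=> *; ring.
Qed.

(* Since [r = t ^ 2], every positive power of [r] gains a factor [t] over the
   same power of [t]. *)
Lemma past_distortion w n : past_finite w -> (0 < n)%N ->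
  (past w * (u ^+ 4) ^+ n + distortion X (u ^+ 4) kap n w <= t * past (th n w))%R.
Proof.
move=> fin n0; rewrite past_iter// mulrDr mulr_sumr.
have pw m : (0 < m)%N -> ((u ^+ 4) ^+ m <= t * t ^+ m)%R.
  move=> m0; have -> : (u ^+ 4 = t * t)%R by rewrite -exprD.
  have tm0 : (0 <= t ^+ m)%R by apply: exprn_ge0; exact: ltW.
  rewrite exprMn ler_wpM2r//.
  move: t t0 t1 m0 {tm0} => x x0 x1; case: m => // m _.
  by rewrite exprS ler_piMr ?exprn_ile1// ltW.
apply: lerD.
  have -> : (t * (t ^+ n * past w) = past w * (t * t ^+ n))%R by rewrite [RHS]mulrC mulrA.
  by rewrite ler_wpM2l ?past_ge0 ?pw.
apply: ler_sum => k _; rewrite [leRHS]mulrCA ler_wpM2l ?kap_ge0// pw//.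
by rewrite subn_gt0.
Qed.

(** For [k <= n], [s ^+ n <= s ^+ k] lets the bound on [kap (th k w) * s ^+ k] apply to every term
    of [past_iter]; the remaining powers of [t] form a geometric series. *)
Lemma past_growth (s : R) : (0 < s < 1)%R ->
  {ae P, forall w, past_finite w ->
    exists K, forall n, (past (th n w) * s ^+ n <= K)%R}.
Proof.
move=> s01; have /andP[s0 s1] := s01.
apply: filterS (kap_growth (theta_measurable X) (@theta_preserving _ _ _ _ X) s01).
move=> w [K K0 KH] fin; exists (past w + K * (1 - t)^-1)%R => n.
rewrite past_iter// mulrDl mulr_suml; apply: lerD.
  rewrite [(t ^+ n * _)%R]mulrC -mulrA ler_piMr ?past_ge0//.
  by rewrite mulr_ile1 ?exprn_ge0 ?exprn_ile1// ltW.
apply: (@le_trans _ _ (\sum_(k < n) K * t ^+ (n - k))%R).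
  apply: ler_sum => k _; rewrite -mulrA [(t ^+ _ * _)%R]mulrC mulrA.
  apply: ler_wpM2r; first by apply: exprn_ge0; exact: ltW.
  apply: le_trans (KH k).
  apply: ler_wpM2l; first exact: kap_ge0.
  by apply: ler_wiXn2l; [exact: ltW|exact: ltW|exact: (ltnW (ltn_ord k))].
rewrite -mulr_sumr ler_wpM2l// (reindex_inj rev_ord_inj)/=.
rewrite (eq_bigr (fun i : 'I_n => t ^+ i.+1)%R).
  by rewrite geometric_sum_le// t1 andbT; exact: ltW.
by move=> i _; rewrite subKn.
Qed.

End DistortionConstant.

(** * Contraction over blocks *)

Section Blocks.
Context {d : measure_display} {Omega : measurableType d} {R : realType}.
Context {P : probability Omega R} (X : rtmc P).
Variables (phi : Omega -> baire -> R) (u : R) (kappa : Omega -> R).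
Hypothesis mphi :
  measurable_fun (total_space X) (fun p : Omega * baire => phi p.1 p.2).
Hypothesis u01 : (0 < u < 1)%R.
Hypothesis kappa0 : forall w, (0 <= kappa w)%R.
Implicit Types (w : Omega) (x y : baire) (a v : seq nat).

Local Notation th n := (iter n (theta X)).
Local Notation t := (u ^+ 2)%R.
Local Notation r := (u ^+ 4)%R.
Local Notation K := (kap u kappa).
Local Notation B := (past X u kappa).

Definition regular w := [/\ has_successors X w, normalized_at X phi w,
  holder_at X phi r K w & past_sum X u kappa w < +oo].

Definition orbit_regular w := forall n, regular (th n w).

Let r01 : (0 < r < 1)%R.
Proof. by case/andP: u01 => u0 u1; rewrite exprn_gt0//= exprn_ilt1// ltW. Qed.

Let t01 : (0 < t < 1)%R.
Proof. by case/andP: u01 => u0 u1; rewrite exprn_gt0//= exprn_ilt1// ltW. Qed.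

Lemma orbit_regular_iter n w : orbit_regular w -> orbit_regular (th n w).
Proof. by move=> reg m; rewrite -iterD. Qed.

Lemma orbit_regular_past w : orbit_regular w -> past_finite X u kappa w.
Proof. by move=> reg n; have [] := reg n. Qed.

(** Far pairs cost nothing extra, as [Delta] never exceeds 1. The case [n = 0] is separate because
    [past_distortion] gains its factor from positive powers only. *)
Lemma contracts_weak n w : orbit_regular w -> contracts X phi r B n w 1.
Proof.
move=> reg; have fin := orbit_regular_past reg.
have /andP[t0 t1] := t01.
have Bn1 : (1 <= B (th n w))%R by exact: past_ge1.
apply: (contracts_coupling (kap := K)) => //.
- exact: kap_ge0.
- by move=> k _; have [] := reg k.
- by move=> k _; have [] := reg k.
- by rewrite ler01 lexx.
- exact: past_ge0.
- rewrite mul1r; case: n Bn1 => [|n] Bn1.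
    by rewrite expr0 mulr1 /distortion big_ord0 addr0.
  apply: le_trans (past_distortion u01 kappa0 fin _) _ => //.
  by rewrite ler_piMl ?past_ge0// ltW.
move=> p [F1 F2] _.
have HL k : (k < n)%N -> forall y, fiber X (th k.+1 w) y ->
    ruelle X phi (th k w) (cst 1) y = 1.
  by move=> _; have [] := reg k.
have B0 : (0 <= B w)%R by exact: past_ge0.
apply: le_trans (coupling_cost_le (c := 1%R) _ _ _ _ _ _ _ _ _) _ => //.
- by move=> a; exact: word_weight_ge0.
- by move=> a; rewrite mul0r word_weight_ge0.
- exact: sum_word_weight.
- exact: sum_word_weight.
- by move=> k; rewrite !lee_fin Delta_ge0//= ge_min lexx.
- by move=> a; rewrite lee_fin ge_min lexx.
- by rewrite mul0r add0r subr0.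
Qed.

(** The probability that the random extension of [x] by [n] letters starts with [v]. *)
Definition prefix_mass n w v x : \bar R :=
  \esum_(a in [set a | take (size v) a = v]) (word_weight X phi n w a x)%:E.

(** The factor [expR (- M')] transfers the mass [eps] from a greedy point to any point with the same
    first letter. Two independent extensions both start with [v] with probability at least
    [(expR (- M') * eps) ^+ 2], and then [Delta <= M * r ^+ size v <= 1/2], which saves one half.
    Close pairs contract by [t]. *)
Lemma contracts_block n w v (M M' eps : R) : orbit_regular w -> (0 < n)%N ->
  (M * r ^+ size v <= 2^-1)%R -> (B w <= M)%R -> (distortion X r K n w <= M')%R ->
  (0 <= eps)%R ->
  (forall c, letters X (th n w) c ->
     eps%:E <= prefix_mass n w v (greedy X c (th n w))) ->
  contracts X phi r B n w (Num.max t (1 - (expR (- M') * eps) ^+ 2 / 2))%R.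
Proof.
move=> reg n0 Mv BM DM eps0 massG; have fin := orbit_regular_past reg.
have /andP[t0 t1] := t01.
have Bn1 : (1 <= B (th n w))%R by exact: past_ge1.
have B0 : (0 <= B w)%R by exact: past_ge0.
have HL k : (k < n)%N -> forall y, fiber X (th k.+1 w) y ->
    ruelle X phi (th k w) (cst 1) y = 1.
  by move=> _; have [] := reg k.
have hol k : (k < n)%N -> holder_at X phi r K (th k w).
  by move=> _; have [] := reg k.
have e0 : (0 <= expR (- M') * eps)%R by rewrite mulr_ge0// expR_ge0.
have mass x : fiber X (th n w) x ->
    (expR (- M') * eps)%:E <= prefix_mass n w v x.
  move=> wx; pose z := greedy X (x 0%N) (th n w).
  have lx : letters X (th n w) (x 0%N) by have [] := wx 0%N.
  apply: (@le_trans _ _ ((expR (- M'))%:E * prefix_mass n w v z)).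
    by rewrite EFinM lee_wpmul2l ?lee_fin ?expR_ge0// massG.
  rewrite /prefix_mass esum_mkcond [leRHS]esum_mkcond -esumZl; last 2 first.
  - by rewrite lee_fin expR_ge0.
  - by move=> a; case: ifP; rewrite // lee_fin word_weight_ge0.
  apply: le_esum => a _; case: ifP => _; last by rewrite mule0.
  rewrite -EFinM lee_fin.
  have : (expR (- (distortion X r K n w * dist_seq r z x)) *
      word_weight X phi n w a z <= word_weight X phi n w a x)%R.
    by apply: word_weight_expR => //; exact: kap_ge0.
  apply: le_trans; rewrite ler_wpM2r ?word_weight_ge0// ler_expR lerN2.
  apply: le_trans DM; rewrite ler_piMr ?dist_seq_le1// distortion_ge0//.
  exact: kap_ge0.
apply: (contracts_coupling (kap := K)) => //.
- exact: kap_ge0.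
- by rewrite le_max (ltW t0)/= ge_max (ltW t1)/= lerBlDr lerDl divr_ge0// exprn_ge0.
- apply: le_trans (past_distortion u01 kappa0 fin n0) _.
  by rewrite ler_wpM2r ?past_ge0// le_max lexx.
move=> p [F1 F2] _.
apply: le_trans (product_cost_le (V := [set a | take (size v) a = v])
  (eps := (expR (- M') * eps)%R) _ _ _ _ _ _ _ _ _) _ => //.
- by move=> a; exact: word_weight_ge0.
- by move=> a; exact: word_weight_ge0.
- exact: sum_word_weight.
- exact: sum_word_weight.
- exact: mass.
- exact: mass.
- by move=> k; rewrite !lee_fin Delta_ge0//= ge_min lexx.
- move=> a b /= va vb; rewrite lee_fin ge_min; apply/orP; right.
  apply: le_trans Mv; apply: ler_pM => //; first exact: dist_seq_ge0.
  have sz c : take (size v) c = v -> (size v <= size c)%N.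
    by move=> <-; rewrite size_take; case: ltnP => // /ltnW.
  apply: dist_seq_agree => // i iv; rewrite /scat.
  rewrite (leq_trans iv (sz _ va)) (leq_trans iv (sz _ vb)).
  by rewrite -(nth_take 0%N iv a) -(nth_take 0%N iv b) va vb.
- by rewrite lee_fin le_max lexx orbT.
Qed.

Lemma measurable_prefix_mass n v c :
  measurable_fun setT (fun w => prefix_mass n w v (greedy X c (th n w))).
Proof.
rewrite (_ : (fun w => _) = fun w => \esum_(a in [set: seq nat])
    (if a \in [set a | take (size v) a = v]
     then (word_weight X phi n w a (greedy X c (th n w)))%:E else 0)); last first.
  by apply/funext => w; rewrite /prefix_mass esum_mkcond.
apply: measurable_esum => [a|a w]; last first.
  by case: ifP; rewrite // lee_fin word_weight_ge0.
case: (_ \in _); last exact: measurable_cst.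
apply/measurable_EFinP; rewrite /word_weight; case: eqP => _; last exact: measurable_cst.
apply: (measurableT_comp (f := fun p : Omega * baire => weight X phi n p.1 p.2)
  (measurable_weight mphi n) (g := fun w => (w, scat a (greedy X c (th n w))))).
apply: measurable_fun_pair => //; apply: (measurableT_comp (measurable_scat a)).
apply: (measurableT_comp (measurable_greedy X c)).
exact: (measurable_iter (theta_measurable X) n).
Qed.

(* The minorization is only required at the greedy points, hence measurable;
   [contracts_block] extends it to the whole fibre by the Hoelder condition. *)
Definition block_set n v (M : R) (k : nat) : set Omega :=
  [set w | [/\ (B w <= M)%R, (distortion X r K n w <= k%:R)%R &
   forall c, letters X (th n w) c ->
     (k.+1%:R^-1)%:E <= prefix_mass n w v (greedy X c (th n w))]].

Hypothesis mkappa : measurable_fun setT kappa.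

Lemma measurable_block_set n v M k : measurable (block_set n v M k).
Proof.
have miter m := measurable_iter (theta_measurable X) m.
have mK : measurable_fun setT K.
  by apply: measurable_funD => //; exact: measurable_cst.
rewrite (_ : block_set n v M k = [set w | (B w <= M)%R] `&`
  [set w | (distortion X r K n w <= k%:R)%R] `&`
  \bigcap_c (th n @^-1` (~` [set w | letters X w c]) `|`
    [set w | (k.+1%:R^-1)%:E <= prefix_mass n w v (greedy X c (th n w))])).
  apply: measurableI; first apply: measurableI.
  - rewrite -[X in measurable X]setTI.
    have mB : measurable_fun setT (fun w => B w <= M)%R.
      by apply: measurable_fun_ler; [exact: measurable_past|exact: measurable_cst].
    exact: (mB measurableT [set true]).
  - rewrite -[X in measurable X]setTI.
    have mD : measurable_fun setT (fun w => distortion X r K n w <= k%:R)%R.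
      apply: measurable_fun_ler; last exact: measurable_cst.
      apply: measurable_sum => i; apply: measurable_funM; last exact: measurable_cst.
      exact: measurableT_comp.
    exact: (mD measurableT [set true]).
  - apply: bigcapT_measurable => c; apply: measurableU.
      rewrite -[X in measurable X]setTI; apply: (miter n measurableT).
      apply: measurableC; exact: letters_measurable.
    rewrite -[X in measurable X]setTI; apply: emeasurable_fun_c_infty => //.
    exact: measurable_prefix_mass.
apply/seteqP; split=> [w [BM Dk H]|w [[BM Dk] H]].
  split=> // c _; have [lc|lc] := pselect (letters X (th n w) c); last by left.
  by right; exact: H.
by split=> // c lc; have [//|] := H c I.
Qed.

End Blocks.

(** * Existence of good blocks *)

Lemma exists_scaled_gt1 {d} {Omega : measurableType d} {R : realType}
    (mu : {measure set Omega -> \bar R}) (A : set Omega) : measurable A ->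
  mu A \is a fin_num -> 0 < mu A -> exists q : nat, 1 < (q%:R)%:E * mu A.
Proof.
move=> mA /fineK; set p := fine _ => pE.
rewrite -pE lte_fin => p0; exists (Num.truncn p^-1).+1.
by rewrite -EFinM lte_fin -ltr_pdivrMr// mul1r truncnS_gt.
Qed.

(** If every slice were null, [A] would be covered by countably many null sets. In [good_block] this
    turns random integers into constants. *)
Lemma positive_slice {d} {T : measurableType d} {R : realType}
    (mu : {measure set T -> \bar R}) (A : set T) (F : nat -> set T) :
  measurable A -> (forall n, measurable (F n)) -> 0 < mu A ->
  {ae mu, forall w, A w -> exists n, F n w} -> exists n, 0 < mu (A `&` F n).
Proof.
move=> mA mF A0 H; apply: contrapT => /forallNP AF0.
have AFN n : mu.-negligible (A `&` F n).
  apply/negligibleP; first exact: measurableI.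
  by apply/eqP; rewrite eq_le measure_ge0 andbT leNgt; apply/negP; exact: AF0.
suff : mu.-negligible A by move/negligibleP => /(_ mA) A0'; rewrite A0' ltxx in A0.
apply: negligibleS (negligibleU H (negligible_bigcup AFN)) => w Aw.
have [[n Fn]|nF] := pselect (exists n, F n w); first by right; exists n.
by left => /(_ Aw).
Qed.

Section VisitsInfinite.
Context {d : measure_display} {Omega : measurableType d}.

Lemma visits_unbounded (T : Omega -> Omega) (A : set Omega) q K w :
  (forall n, n <= q * visits T A n w + K)%N ->
  forall m, exists2 k, (m <= k)%N & A (iter k T w).
Proof.
move=> H m; apply: contrapT => nA.
have bnd n : (visits T A n w <= m)%N.
  rewrite /visits; elim: n => [|n IH]; first by rewrite big_ord0.
  rewrite big_ord_recr/=; have [mn|nm] := leqP m n.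
    by rewrite memNset ?addn0// => An; apply: nA; exists n.
  apply: (@leq_trans n.+1) => //.
  have -> : n.+1 = ((\sum_(k < n) 1) + 1)%N by rewrite big_const_ord iter_addn_0 mul1n addn1.
  by apply: leq_add; [apply: leq_sum => i _|]; exact: leq_b1.
have := H (q * m + K).+1; rewrite ltnNge => /negP; apply.
by rewrite leq_add2r leq_mul2l bnd orbT.
Qed.

End VisitsInfinite.

Section GoodBlock.
Context {d : measure_display} {Omega : measurableType d} {R : realType}.
Context {P : probability Omega R} (X : rtmc P).
Variables (phi : Omega -> baire -> R) (u : R) (kappa : Omega -> R).
Hypothesis u01 : (0 < u < 1)%R.
Hypothesis kappa0 : forall w, (0 <= kappa w)%R.
Implicit Types (w : Omega) (x y : baire) (a v : seq nat).

Local Notation th n := (iter n (theta X)).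
Local Notation r := (u ^+ 4)%R.
Local Notation K := (kap u kappa).
Local Notation B := (past X u kappa).

Let r01 : (0 < r < 1)%R.
Proof. by case/andP: u01 => u0 u1; rewrite exprn_gt0//= exprn_ilt1// ltW. Qed.

Definition var1_bounded w := exists C : R, forall x y, fiber X w x ->
  fiber X w y -> x 0%N = y 0%N -> (`|phi w x - phi w y| <= C)%R.

Variables (Obp : set Omega) (I : set nat).
Hypothesis finI : finite_set I.
Hypothesis bpI : forall w c, Obp w -> letters X w c ->
  exists2 b, I b & words X 2 (thetaV X w) [:: b; c].

Lemma prepend_bp n w x : Obp (th n.+1 w) -> fiber X (th n.+1 w) x ->
  exists2 b, I b & fiber X (th n w) (scat [:: b] x).
Proof.
move=> Ow wx; have [lx _ _] := wx 0%N.
have [b Ib] := bpI Ow lx; rewrite theta_iterV => wb; exists b => //.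
exact: (words_scat (u := [:: b]) (m := 1) (e := x 0%N) _ wb).
Qed.

Lemma prefix_mass_positive m l w s e :
  size s = m -> words X m.+1 w (rcons s e) -> (0 < l)%N ->
  orbit_regular X phi u kappa w -> Obp (th (l + m).+1 w) ->
  var1_bounded (th (l + m) w) ->
  (forall b, I b -> Omega_ X [:: b] (th (l + m) w) ->
     cylinder X [:: e] (th m w) `&`
     (iter l seq_shift @^-1` cylinder X [:: b] (th (l + m) w)) !=set0) ->
  exists k, forall x, fiber X (th (l + m).+1 w) x ->
    (k.+1%:R^-1)%:E <= prefix_mass X phi (l + m).+1 w (rcons s e) x.
Proof.
move=> sm ws l0 reg Ow [C varC] mix; set n := (l + m).+1.
pose Q b (eps : R) := forall x, fiber X (th n w) x ->
  fiber X (th (l + m) w) (scat [:: b] x) ->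
  exists a, [/\ size a = n, take m.+1 a = rcons s e &
    (eps <= word_weight X phi n w a x)%R].
have [eps e0 Qeps] : exists2 eps, (0 < eps)%R & forall b, I b -> Q b eps.
  apply: finite_min => // [b e1 e2 le21 Qb x wx wbx|b Ib].
    by have [a [sa ta wa]] := Qb x wx wbx; exists a; split=> //; exact: le_trans wa.
  (* If [b] precedes no point of the fibre, [Q b] is vacuous; otherwise [b] occurs at that place and
     mixing supplies a path from [e] to [b]. *)
  have [[x1 [wx1 wbx1]]|nx] := pselect (exists x, fiber X (th n w) x /\
      fiber X (th (l + m) w) (scat [:: b] x)); last first.
    by exists 1%R => // x wx wbx; case: nx; exists x.
  have Ob : Omega_ X [:: b] (th (l + m) w).
    by exists (scat [:: b] x1); split=> // -[].
  have [y' [[wy' ye] [wly' yb]]] := mix b Ib Ob.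
  have {ye} ye : y' 0%N = e by exact: (ye 0%N).
  have {yb} yb : y' l = b by have := yb 0%N isT; rewrite iter_shiftE addn0.
  pose y0 := scat s y'.
  have wy0 : fiber X w y0 by exact: (words_scat sm ws).
  have y0b : y0 (l + m)%N = b.
    by rewrite /y0 /scat sm ltnNge leq_addl /= addnK.
  (* [D] bounds the change of the Birkhoff sum from the reference path [y0] to the extension of any
     [x] by the same word; it does not depend on [x]. *)
  pose D := (\sum_(k < n) K (th k w) + C)%R.
  exists (expR (birkhoff X phi n w y0 - D)); first exact: expR_gt0.
  move=> x wx wbx; exists (mkseq y0 n); rewrite size_mkseq; split=> //.
    rewrite /mkseq -map_take take_iota (minn_idPl _); last by rewrite ltnS leq_addl.
    rewrite -[m.+1]addn1 iotaD map_cat cats1.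
    rewrite -/(mkseq y0 m) -{1}sm mkseq_scat; congr rcons.
    by rewrite add0n /y0 /scat sm ltnn subnn.
  have aE : scat (mkseq y0 n) x = scat (mkseq y0 (l + m)) (scat [:: b] x).
    rewrite -scat_cat; congr scat.
    by rewrite /mkseq /n -[(l + m).+1]addn1 iotaD map_cat add0n /= y0b.
  have wax : fiber X w (scat (mkseq y0 n) x).
    rewrite aE; apply: (fiber_scat_first (n := (l + m)%N)
      (x := iter (l + m) seq_shift y0)); rewrite ?size_mkseq ?scat_shift//.
    by rewrite iter_shiftE addn0 y0b.
  have agree i : (i < n)%N -> scat (mkseq y0 n) x i = y0 i.
    by move=> im; rewrite /scat size_mkseq im nth_mkseq.
  rewrite /word_weight size_mkseq eqxx weightE// ler_expR lerBlDr -lerBlDl.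
  apply: le_trans (ler_norm _) _; rewrite /birkhoff -sumrB.
  apply: le_trans (ler_norm_sum _ _ _) _.
  rewrite /D /n !big_ord_recr/= -addrA; apply: lerD.
    apply: ler_sum => k _; have [_ _ hol _] := reg k.
    have kn := ltn_ord k.
    apply: (@le_trans _ _ (K (th k w) * r ^+ 2)%R).
      apply: hol => //; [exact: fiber_shift|exact: fiber_shift|].
      move=> i i2; rewrite !iter_shiftE agree// /n; lia.
    rewrite ler_piMr ?kap_ge0// exprn_ile1//; first by case/andP: r01 => /ltW.
    by case/andP: r01 => _ /ltW.
  (* In the last term the two paths are only known to share the letter [b], too little for
     [holder_at]; the bound on the first variation takes over. *)
  apply: (@le_trans _ _ C); last by rewrite lerDr kap_ge0.
  apply: varC; [exact: fiber_shift|exact: fiber_shift|].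
  by rewrite !iter_shiftE addn0 agree.
have [k ke] : exists k, (k.+1%:R^-1 <= eps)%R.
  exists (Num.truncn eps^-1); rewrite -[leRHS]invrK lef_pV2 ?posrE ?invr_gt0//.
  by rewrite ltW// truncnS_gt.
exists k => x wx; have [b Ib wbx] := prepend_bp Ow wx.
have [a [sa ta wa]] := Qeps b Ib x wx wbx.
apply: (@le_trans _ _ (word_weight X phi n w a x)%:E).
  by rewrite lee_fin (le_trans ke).
rewrite /prefix_mass esum_mkcond size_rcons sm.
apply: le_trans (esum_ge_term a _); last first.
  by move=> a'; case: ifP; rewrite // lee_fin word_weight_ge0.
by rewrite mem_set.
Qed.

End GoodBlock.

Lemma geometric_small {R : realType} (x M : R) : (0 < x < 1)%R ->
  exists n, (M * x ^+ n.+1 <= 2^-1)%R.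
Proof.
move=> /andP[x0 x1]; pose e := (2^-1 / (1 + `|M|))%R.
have M0 : (0 < 1 + `|M|)%R by rewrite ltr_pwDl.
have e0 : (0 < e)%R by rewrite divr_gt0.
have : (x ^+ n @[n --> \oo] --> (0 : R))%R by apply: cvg_expr; rewrite gtr0_norm.
move=> /cvgrPdist_lt /(_ e e0) [n _ /(_ n.+1 (leqnSn n))] /=.
rewrite sub0r normrN ger0_norm ?exprn_ge0 ?(ltW x0)// => xe; exists n.
apply: (@le_trans _ _ (`|M| * x ^+ n.+1)%R).
  by rewrite ler_wpM2r ?ler_norm// exprn_ge0// ltW.
apply: (@le_trans _ _ ((1 + `|M|) * e)%R); last by rewrite /e mulrC divfK ?gt_eqF.
by apply: ler_pM => //; [rewrite exprn_ge0// ltW|rewrite lerDr|exact: ltW].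
Qed.

Section GoodBlockExists.
Context {d : measure_display} {Omega : measurableType d} {R : realType}.
Context {P : probability Omega R} (X : rtmc P).
Variables (phi : Omega -> baire -> R) (u : R) (kappa : Omega -> R).
Hypothesis mphi :
  measurable_fun (total_space X) (fun p : Omega * baire => phi p.1 p.2).
Hypothesis u01 : (0 < u < 1)%R.
Hypothesis kappa0 : forall w, (0 <= kappa w)%R.
Hypothesis mkappa : measurable_fun setT kappa.
Variables (Obp : set Omega) (I : set nat).
Hypothesis finI : finite_set I.
Hypothesis bpI : forall w c, Obp w -> letters X w c ->
  exists2 b, I b & words X 2 (thetaV X w) [:: b; c].
Hypothesis mObp : measurable Obp.
Hypothesis Obp0 : 0 < P Obp.
Hypothesis mixing : top_mixing X.
Hypothesis ae_reg : {ae P, forall w, orbit_regular X phi u kappa w}.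
Hypothesis ae_letters : {ae P, forall w, exists i, letters X w i}.
Hypothesis ae_var1 :
  {ae P, forall w, Obp (theta X w) -> var1_bounded X phi w}.

Local Notation th n := (iter n (theta X)).
Local Notation r := (u ^+ 4)%R.
Local Notation B := (past X u kappa).

Let r01 : (0 < r < 1)%R.
Proof. by case/andP: u01 => u0 u1; rewrite exprn_gt0//= exprn_ilt1// ltW. Qed.

Let mth n := measurable_iter (theta_measurable X) n.

Let preth := @theta_preserving _ _ _ _ X.

Let measurable_th_preimage n (A : set Omega) : measurable A ->
  measurable (th n @^-1` A).
Proof. by move=> mA; rewrite -[X in measurable X]setTI; exact: (mth n measurableT). Qed.

Lemma measurable_words n a : measurable [set w | words X n w a].
Proof.
rewrite (_ : mkset _ = [set _ | size a = n] `&`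
  (\bigcap_(i in [set i | (i < n)%N])
     th i @^-1` [set w | letters X w (nth 0%N a i)] `&`
   \bigcap_(i in [set i | (i.+1 < n)%N])
     th i @^-1` allowed X (nth 0%N a i) (nth 0%N a i.+1))).
  apply: measurableI; first exact: measurable_cst_set.
  apply: measurableI; apply: bigcap_measurableType => i _;
    apply: measurable_th_preimage; first exact: letters_measurable.
  exact: alpha_measurable.
apply/seteqP; split=> w [sa].
  move=> la aa; split=> //; split=> i im; first exact: la.
  by split; [apply: la; exact: ltnW|exact: (la i.+1)|exact: aa].
by move=> [la aa]; split=> // i im; have [] := aa i im.
Qed.

Lemma fiber_words w y n : fiber X w y -> words X n w (mkseq y n).
Proof.
move=> wy; split; first by rewrite size_mkseq.
- by move=> i im; rewrite nth_mkseq//; have [] := wy i.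
- by move=> i im; rewrite !nth_mkseq ?(ltnW im)//; have [] := wy i.
Qed.

Lemma ae_visits_Obp :
  {ae P, forall w, forall m, exists2 k, (m <= k)%N & Obp (th k w)}.
Proof.
have [q qP] := exists_scaled_gt1 mObp (fin_num_measure P _ mObp) Obp0.
apply: filterS (visits_linear (theta_measurable X) preth mObp _ qP) => //.
  move=> w [K /visits_unbounded]; exact.
by move=> A mA; exact: theta_ergodic.
Qed.

(** Each random quantity is frozen by [positive_slice], in an order dictated by dependence: [M]
    bounds [B] and fixes the length of [v]; the last letter of [v] determines the mixing times,
    whose bound [n0] must be exceeded by [l]; only with the block length known can distortion and
    mass be bounded through [k]. *)
Lemma good_block : exists n v (M : R) k,
  [/\ (0 < n)%N, (M * r ^+ size v <= 2^-1)%R &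
      0 < P (block_set X phi u kappa n v M k)].
Proof.
have mB M : measurable [set w | (B w <= M)%R].
  rewrite -[X in measurable X]setTI.
  have mB : measurable_fun setT (fun w => B w <= M)%R.
    by apply: measurable_fun_ler; [exact: measurable_past|exact: measurable_cst].
  exact: (mB measurableT [set true]).
have [M0 PM] : exists M : nat, 0 < P (setT `&` [set w | (B w <= M%:R)%R]).
  apply: positive_slice => //.
    by have := @lte01 R; rewrite -(@probability_setT _ _ _ P).
  apply: aeW => w _; exists (Num.truncn (B w)).+1.
  by rewrite /= ltW// truncnS_gt.
rewrite setTI in PM; set M : R := M0%:R in PM.
have [m Mm] := geometric_small M r01.
pose F1 i : set Omega :=
  if unpickle i is Some a then [set w | words X m.+1 w a] else set0.
have [i] : exists i, 0 < P ([set w | (B w <= M)%R] `&` F1 i).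
  apply: positive_slice => //.
    by move=> i; rewrite /F1; case: unpickle => // a; exact: measurable_words.
  apply: filterS2 ae_reg ae_letters => w reg [c wc] _.
  exists (pickle (mkseq (greedy X c w) m.+1)); rewrite /F1 pickleK /=.
  by apply/fiber_words/greedy_fiber => // n; have [] := reg n.
rewrite /F1; case: unpickle => [v|]; last by rewrite setI0 measure0 ltxx.
set A1 := _ `&` _ => PA1.
have mA1 : measurable A1 by apply: measurableI => //; exact: measurable_words.
have [s [e [vE sm]]] : exists s e, v = rcons s e /\ size s = m.
  have [w [_ [sv _ _]]] : A1 !=set0.
    by apply/set0P; apply/negP => /eqP A10; rewrite A10 measure0 ltxx in PA1.
  case/lastP: v sv {A1 PA1 mA1} => // s e; rewrite size_rcons => -[sm].
  by exists s, e.
have A1_null Q : {ae P, forall w, Q w} -> (forall w, A1 w -> ~ Q w) -> False.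
  move=> [N [mN N0 QN]] A1Q; move: PA1; apply/negP; rewrite -leNgt -N0.
  by apply: le_measure; rewrite ?inE// => w A1w; apply: QN; exact: A1Q.
have Omega_ae b n : P.-negligible (Omega_ X [:: b]) ->
    {ae P, forall w, ~ Omega_ X [:: b] (th n w)}.
  move=> H; apply: (ae_preserving_iter (theta_measurable X) preth
    (Q := fun w => ~ Omega_ X [:: b] w)).
  by apply: negligibleS H => w; exact: contrapT.
have lastA1 w : A1 w -> words X m.+1 w (rcons s e) by rewrite -vE => -[].
(* Mixing speaks only of letters whose [Omega_] is not negligible. If [Omega_ [:: e]] were
   negligible, [A1] would be null, since over almost every point of [A1] the greedy path from [e]
   shows that [e] occurs at time [m]. *)
have global_e : global_words X 1 [:: e].
  split=> // /(Omega_ae e m) H.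
  apply: (@A1_null (fun w => orbit_regular X phi u kappa w /\
    ~ Omega_ X [:: e] (th m w))).
    by apply: filterS2 ae_reg H.
  move=> w /lastA1[_ lw _] [reg]; apply.
  have le : letters X (th m w) e.
    by have := lw m (ltnSn m); rewrite nth_rcons sm ltnn eqxx.
  exists (greedy X e (th m w)); split; last by case.
  apply: greedy_fiber le => n; rewrite -iterD; by have [] := reg (n + m)%N.
have /choice[N NP] b : exists N : Omega -> nat, measurable_fun setT N /\
    (global_words X 1 [:: b] ->
     {ae P, forall w, forall n, (N w <= n)%N -> letters X w e ->
      Omega_ X [:: b] (th n w) ->
      cylinder X [:: e] w `&`
        (iter n seq_shift @^-1` cylinder X [:: b] (th n w)) !=set0}).
  have [gb|ngb] := pselect (global_words X 1 [:: b]).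
    by have [N mN HN] := mixing global_e gb; exists N.
  (* A letter that is not global gets a dummy time: almost surely it does not occur, so nothing is
     asked of it later. *)
  by exists (cst 0%N); split=> //; exact: measurable_cst.
pose F2 n := \bigcap_(b in I) [set w | (N b (th m w) <= n)%N].
have [n0 PA2] : exists n0, 0 < P (A1 `&` F2 n0).
  apply: positive_slice => //.
    move=> n; apply: bigcap_measurableType => b _.
    apply: (measurable_th_preimage m (A := [set w | (N b w <= n)%N])).
    rewrite -[X in measurable X]setTI.
    by apply: ((NP b).1 measurableT [set j | (j <= n)%N]).
  apply: aeW => w _; have [n Hn] := finite_max (fun b => N b (th m w)) finI.
  by exists n => b Ib; exact: Hn.
set A2 := _ `&` _ in PA2.
have mA2 : measurable A2.
  apply: measurableI => //; apply: bigcap_measurableType => b _.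
  apply: (measurable_th_preimage m (A := [set w | (N b w <= n0)%N])).
  rewrite -[X in measurable X]setTI.
  by apply: ((NP b).1 measurableT [set j | (j <= n0)%N]).
pose F3 l := [set w | (n0 < l)%N] `&` th (l + m).+1 @^-1` Obp.
have mF3 l : measurable (F3 l).
  apply: measurableI; first exact: measurable_cst_set.
  exact: measurable_th_preimage.
have [l PA3] : exists l, 0 < P (A2 `&` F3 l).
  apply: positive_slice => //; apply: filterS ae_visits_Obp => w H _.
  (* The visit to [Obp] must take place at time [(l + m).+1], hence [l = k - m.+1]; the margin in
     [(n0 + m).+2] ensures [n0 < l]. *)
  have [k nk Ok] := H (n0 + m).+2.
  have kE : ((k - m.+1) + m).+1 = k by lia.
  by exists (k - m.+1)%N; split; [rewrite /=; lia|rewrite /= -iterS kE].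
set A3 := _ `&` _ in PA3.
have mA3 : measurable A3 by exact: measurableI.
have [k PA4] : exists k, 0 < P (A3 `&` block_set X phi u kappa (l + m).+1 v M k).
  apply: positive_slice => //.
    by move=> k; apply: measurable_block_set.
  have aemix : {ae P, forall w, forall b, I b -> Omega_ X [:: b] (th (l + m) w) ->
     (N b (th m w) <= l)%N -> letters X (th m w) e ->
     cylinder X [:: e] (th m w) `&`
     (iter l seq_shift @^-1` cylinder X [:: b] (th (l + m) w)) !=set0}.
    apply/ae_foralln => b.
    have [gb|ngb] := pselect (global_words X 1 [:: b]).
      have := ae_preserving_iter (theta_measurable X) preth m ((NP b).2 gb).
      apply: filterS => w H _ Ob Nl le; rewrite iterD; apply: H => //.
      by rewrite -iterD.
    have nO : P.-negligible (Omega_ X [:: b]).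
      by apply: contrapT => nO; apply: ngb.
    by apply: filterS (Omega_ae b (l + m)%N nO) => w nOb _ Ob.
  have aevar := ae_preserving_iter (theta_measurable X) preth (l + m)%N ae_var1.
  apply: filterS3 ae_reg aemix aevar => w reg mix var [[A1w F2w] [n0l Ow]].
  have le : letters X (th m w) e.
    have [_ lw _] := lastA1 w A1w.
    by have := lw m (ltnSn m); rewrite nth_rcons sm ltnn eqxx.
  have l0 : (0 < l)%N by apply: leq_ltn_trans n0l.
  have [k1 kH] := prefix_mass_positive u01 kappa0 finI bpI sm (lastA1 w A1w) l0
    reg Ow (var Ow) (fun b Ib Ob => mix b Ib Ob
      (leq_trans (F2w b Ib) (ltnW n0l)) le).
  pose D := distortion X r (kap u kappa) (l + m).+1 w.
  (* Increasing [k] relaxes both the distortion bound and the mass bound, so one integer can serve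
     for the two. *)
  exists (maxn k1 (Num.truncn D).+1); split.
  - by case: A1w.
  - apply: (@le_trans _ _ (Num.truncn D).+1%:R); first by rewrite ltW// truncnS_gt.
    by rewrite ler_nat leq_maxr.
  - move=> c lc; rewrite vE; apply: le_trans (kH _ _); last first.
      apply: greedy_fiber lc => j; rewrite -iterD.
      by have [] := reg (j + (l + m).+1)%N.
    by rewrite lee_fin lef_pV2 ?posrE ?ltr0Sn// ler_nat ltnS leq_maxl.
exists (l + m).+1, v, M, k; split=> //; first by rewrite vE size_rcons sm.
apply: (lt_le_trans PA4); apply: le_measure; rewrite ?inE//.
- by apply: measurableI => //; exact: measurable_block_set.
- exact: measurable_block_set.
Qed.

End GoodBlockExists.

(** * Exponential contraction *)

Lemma root_lower_bound {R : realFieldType} (lam : R) n : (0 < lam < 1)%R -> (0 < n)%N ->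
  exists2 s, (0 < s < 1)%R & (lam <= s ^+ n)%R.
Proof.
(* Bernoulli's inequality for [s = 1 - x] gives [s ^+ n >= 1 - n * x = lam]. *)
move=> /andP[l0 l1] n0; pose x := ((1 - lam) / n%:R)%R.
have n0R : (0 < n%:R :> R)%R by rewrite ltr0n.
have x0 : (0 < x)%R by rewrite divr_gt0// subr_gt0.
have x1 : (x < 1)%R.
  rewrite ltr_pdivrMr// mul1r; apply: (@lt_le_trans _ _ 1%R); first by lra.
  by rewrite ler1n.
exists (1 - x)%R; first by apply/andP; split; lra.
have bern m : (1 - m%:R * x <= (1 - x) ^+ m)%R.
  elim: m => [|m IH]; first by rewrite mul0r subr0 expr0.
  have mx : (0 <= m%:R * x)%R by rewrite mulr_ge0// ltW.
  rewrite exprS -natr1.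
  apply: (@le_trans _ _ ((1 - x) * (1 - m%:R * x))%R); first by nra.
  by rewrite ler_wpM2l// subr_ge0 ltW.
by apply: le_trans (bern n); rewrite /x mulrC divfK ?gt_eqF// subKr.
Qed.

Lemma visits_leq {d} {Omega : measurableType d} (T : Omega -> Omega) A n w : (visits T A n w <= n)%N.
Proof.
rewrite /visits -[leqRHS]card_ord -sum1_card.
by apply: leq_sum => i _; exact: leq_b1.
Qed.

Lemma visitsD {d} {Omega : measurableType d} (T : Omega -> Omega) A k n w :
  visits T A (k + n) w = (visits T A n w + visits T A k (iter n T w))%N.
Proof.
rewrite addnC /visits big_split_ord/=; congr addn.
by apply: eq_bigr => i _; rewrite addnC iterD.
Qed.

Section Assembly.
Context {d : measure_display} {Omega : measurableType d} {R : realType}.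
Context {P : probability Omega R} (X : rtmc P).
Variables (phi : Omega -> baire -> R) (u : R) (kappa : Omega -> R).
Hypothesis mphi :
  measurable_fun (total_space X) (fun p : Omega * baire => phi p.1 p.2).
Hypothesis u01 : (0 < u < 1)%R.
Hypothesis kappa0 : forall w, (0 <= kappa w)%R.

Local Notation th n := (iter n (theta X)).
Local Notation thV n := (iter n (thetaV X)).
Local Notation r := (u ^+ 4)%R.
Local Notation B := (past X u kappa).
Local Notation reg := (orbit_regular X phi u kappa).

Lemma thVK n w : th n (thV n w) = w.
Proof. by elim: n w => // n IH w; rewrite iterSr iterS thetaVK IH. Qed.

(** Time reversal turns a count started at the moving point [thV n w] into a count along the
    backward orbit of the fixed point [w]; the preimage of [A] accounts for the shift by one
    step. *)
Lemma visits_thV A n w :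
  visits (theta X) A n (thV n w) = visits (thetaV X) (thetaV X @^-1` A) n w.
Proof.
rewrite /visits (reindex_inj rev_ord_inj)/=; apply: eq_bigr => i _.
have -> : th (n - i.+1) (thV n w) = thetaV X (thV i w).
  have -> : thV n w = thV (n - i.+1) (thV i.+1 w) by rewrite -iterD subnK.
  by rewrite thVK iterS.
by congr nat_of_bool; apply/idP/idP => /set_mem H; exact: mem_set.
Qed.

(** The orbit is cut greedily: a visit to [G] opens a block of length [n0] with factor [lam], any
    other time advances by one step without expansion. A block swallows at most [n0] visits, and
    fewer than [n0] remain at the end. *)
Lemma contracts_visits (G : set Omega) n0 lam : (0 < n0)%N -> (0 < lam)%R ->
  (forall w, G w -> reg w -> contracts X phi r B n0 w lam) ->
  forall n w, reg w -> exists2 j,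
    (visits (theta X) G n w <= n0 * j + n0)%N & contracts X phi r B n w (lam ^+ j)%R.
Proof.
move=> n00 l0 conG; elim/ltn_ind => n IH w rw.
have [nn0|n0n] := ltnP n n0.
  exists 0%N; first by rewrite muln0 add0n (leq_trans (visits_leq _ _ _ _))// ltnW.
  by rewrite expr0; exact: contracts_weak.
have [Gw|nGw] := pselect (G w).
  have [|j vj cj] := IH (n - n0)%N _ (th n0 w) (orbit_regular_iter n0 rw); first by lia.
  exists j.+1.
    rewrite -(subnK n0n) visitsD mulnS.
    have := visits_leq (theta X) G n0 w; lia.
  rewrite [(lam ^+ _.+1)%R]exprS -(subnK n0n).
  apply: (contracts_comp mphi) => //; first exact: ltW.
  exact: conG.
have n1 : (0 < n)%N by apply: leq_trans n0n.
have [|j vj cj] := IH n.-1 _ (th 1 w) (orbit_regular_iter 1 rw); first by lia.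
exists j; first by rewrite -(prednK n1) visitsS memNset.
rewrite -(mul1r (lam ^+ j)%R) -(prednK n1) -(addn1 n.-1).
by apply: (contracts_comp mphi) => //; exact: contracts_weak.
Qed.

End Assembly.

Lemma vasershtein_ge0 {R : realType} (r : R) M1 M2 : (0 < r < 1)%R ->
  0 <= vasershtein r M1 M2.
Proof.
move=> r01; apply: le_ereal_inf_tmp => _ [m _ <-].
by apply: integral_ge0 => p _; rewrite lee_fin dist_seq_ge0.
Qed.

Lemma decay_rate {R : realFieldType} (s1 s0 : R) q K n v :
  (0 < s0 < 1)%R -> (0 < s1)%R -> (s1 <= s0 ^+ q)%R -> (n <= q * v + K)%N ->
  (s1 ^+ v <= s0 ^- K * s0 ^+ n)%R.
Proof.
move=> /andP[s00 s01] s10 s1q nK.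
apply: (@le_trans _ _ (s0 ^+ (q * v))%R).
  rewrite exprM; apply: lerXn2r => //; rewrite nnegrE; first exact: ltW.
  by apply: exprn_ge0; exact: ltW.
rewrite mulrC ler_pdivlMr ?exprn_gt0// -exprD.
by apply: ler_wiXn2l => //; exact: ltW.
Qed.

Section MainContraction.
Context {d : measure_display} {Omega : measurableType d} {R : realType}.
Context {P : probability Omega R} (X : rtmc P).
Variables (phi : Omega -> baire -> R) (u : R) (kappa : Omega -> R).
Hypothesis mphi :
  measurable_fun (total_space X) (fun p : Omega * baire => phi p.1 p.2).
Hypothesis u01 : (0 < u < 1)%R.
Hypothesis kappa0 : forall w, (0 <= kappa w)%R.
Hypothesis mkappa : measurable_fun setT kappa.
Hypothesis ikappa : \int[P]_w ((fun v => lne (kappa v)%:E)^\+ w) < +oo.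
Hypothesis ae_reg : {ae P, forall w, orbit_regular X phi u kappa w}.

Local Notation th n := (iter n (theta X)).
Local Notation thV n := (iter n (thetaV X)).
Local Notation r := (u ^+ 4)%R.
Local Notation B := (past X u kappa).
Local Notation reg := (orbit_regular X phi u kappa).

Let mth := theta_measurable X.
Let mthV := thetaV_measurable X.
Let preth := @theta_preserving _ _ _ _ X.
Let prethV := thetaV_preserving X.

Variables (G : set Omega) (n0 : nat) (lam : R).
Hypothesis mG : measurable G.
Hypothesis G0 : 0 < P G.
Hypothesis n00 : (0 < n0)%N.
Hypothesis lam01 : (0 < lam < 1)%R.
Hypothesis conG : forall w, G w -> reg w -> contracts X phi r B n0 w lam.

(** [s1] is the rate per visit to [G] and [s0] the rate per unit of time, visits having frequency at
    least [1 / q]. Half of the exponent, [s = sqrt s0], is kept; the other half absorbs the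
    subexponential growth of [B (th n w)]. *)
Lemma uniform_contraction : exists (s : R) (c : Omega -> R),
  [/\ (0 < s < 1)%R, measurable_fun setT c, (forall w, (0 < c w)%R) &
   {ae P, forall w, forall n,
     (exists2 l, (0 < l)%R /\ (l * B w <= c w * s ^+ n)%R &
        contracts X phi r B n (thV n w) l) /\
     (exists2 l, (0 < l)%R /\ (l * B (th n w) <= c w * s ^+ n)%R &
        contracts X phi r B n w l)}].
Proof.
have /andP[l0 l1] := lam01.
have [s1 /andP[s10 s11] lams1] := root_lower_bound lam01 n00.
have [q qG] := exists_scaled_gt1 mG (fin_num_measure P _ mG) G0.
have q0 : (0 < q)%N.
  by case: q qG => //; rewrite mul0e ltNge lee01.
have [s0 s001 s1s0] := root_lower_bound (introT andP (conj s10 s11)) q0.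
have [s00 s01] := andP s001.
pose s := Num.sqrt s0.
have s_gt0 : (0 < s)%R by rewrite sqrtr_gt0.
have s2 : (s ^+ 2 = s0)%R by rewrite sqr_sqrtr// ltW.
have s_lt1 : (s < 1)%R.
  rewrite ltNge; apply/negP => s_ge1; move: s01; rewrite -s2 ltNge.
  by rewrite exprn_ege1.
have s_le1 n : (s ^+ n <= 1)%R by rewrite exprn_ile1// ltW.
have sn0 n : (0 < s ^+ n)%R by rewrite exprn_gt0.
have s0n n : (s0 ^+ n = s ^+ n * s ^+ n)%R by rewrite -s2 -exprM mulnC exprM expr2.
have B0 w : (0 <= B w)%R by exact: past_ge0.
have mB : measurable_fun setT B by exact: measurable_past.
have mpow v : measurable_fun setT v ->
    measurable_fun setT (fun w : Omega => s1 ^+ v w)%R.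
  by move=> mv; apply: (measurableT_comp (f := fun k : nat => s1 ^+ k)%R).
have cntF := visits_linear mth preth mG (@theta_ergodic _ _ _ _ X) qG.
have mVG : measurable (thetaV X @^-1` G).
  by rewrite -[X in measurable X]setTI; exact: mthV.
(* [theta] and its inverse have the same invariant sets. *)
have ergV A : measurable A -> thetaV X @^-1` A = A -> P A = 0 \/ P A = 1.
  move=> mA VA; apply: (@theta_ergodic _ _ _ _ X) => //.
  by rewrite -{1}VA; apply/seteqP; split=> w /=; rewrite thetaK.
have cntB : {ae P, forall w, exists K, forall n,
    (n <= q * visits (thetaV X) (thetaV X @^-1` G) n w + K)%N}.
  by apply: (visits_linear mthV prethV mVG ergV); rewrite prethV.
have [c1 [mc1 c10 c1H]] : exists c1 : Omega -> R,
   [/\ measurable_fun setT c1, forall w, (0 < c1 w)%R &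
    {ae P, forall w, forall n,
      (s1 ^+ visits (theta X) G n w * B (th n w) / s ^+ n <= c1 w)%R}].
  apply: (measurable_upper_bound
    (u := fun n w => s1 ^+ visits (theta X) G n w * B (th n w) / s ^+ n)%R).
  - move=> n; apply: measurable_funM; last exact: measurable_cst.
    apply: measurable_funM; first by apply: mpow; exact: measurable_visits.
    by apply: (measurableT_comp mB); exact: measurable_iter.
  - by move=> n w; rewrite divr_ge0 ?(ltW (sn0 n))// mulr_ge0// exprn_ge0// ltW.
  have s_01 : (0 < s < 1)%R by apply/andP.
  have grow := past_growth X u01 mkappa kappa0 ikappa s_01.
  apply: filterS3 ae_reg cntF grow.
  move=> w rw [K KH] /(_ (orbit_regular_past rw)) [K2 K2H].
  exists (s0 ^- K * K2)%R => n.
  rewrite ler_pdivrMr//.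
  apply: (@le_trans _ _ (s0 ^- K * s0 ^+ n * B (th n w))%R).
    by rewrite ler_wpM2r// (decay_rate s001 s10 s1s0 (KH n)).
  have -> : (s0 ^- K * s0 ^+ n * B (th n w) =
             s0 ^- K * (B (th n w) * s ^+ n) * s ^+ n)%R by rewrite (s0n n); ring.
  apply: ler_wpM2r; first exact: ltW.
  by apply: ler_wpM2l => //; rewrite invr_ge0; apply: exprn_ge0; exact: ltW.
have [c2 [mc2 c20 c2H]] : exists c2 : Omega -> R,
   [/\ measurable_fun setT c2, forall w, (0 < c2 w)%R &
    {ae P, forall w, forall n,
      (s1 ^+ visits (theta X) G n (thV n w) * B w / s ^+ n <= c2 w)%R}].
  apply: (measurable_upper_bound
    (u := fun n w => s1 ^+ visits (theta X) G n (thV n w) * B w / s ^+ n)%R).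
  - move=> n; apply: measurable_funM; last exact: measurable_cst.
    apply: measurable_funM => //; apply: mpow.
    apply: (measurableT_comp (measurable_visits mth n mG)).
    exact: measurable_iter.
  - by move=> n w; rewrite divr_ge0 ?(ltW (sn0 n))// mulr_ge0// exprn_ge0// ltW.
  apply: filterS cntB => w [K KH]; exists (s0 ^- K * B w)%R => n.
  rewrite ler_pdivrMr// visits_thV.
  apply: (@le_trans _ _ (s0 ^- K * s0 ^+ n * B w)%R).
    by rewrite ler_wpM2r// (decay_rate s001 s10 s1s0 (KH n)).
  have -> : (s0 ^- K * s0 ^+ n * B w = s0 ^- K * B w * s ^+ n * s ^+ n)%R.
    by rewrite (s0n n); ring.
  apply: ler_wpM2r; first exact: ltW.
  rewrite ler_piMr//; apply: mulr_ge0 => //.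
  by rewrite invr_ge0; apply: exprn_ge0; exact: ltW.
(* [C0] pays for the at most [n0] visits not covered by complete blocks. *)
pose C0 : R := (s1 ^- n0)%R.
have C00 : (0 < C0)%R by rewrite invr_gt0 exprn_gt0.
have lamj j v : (v <= n0 * j + n0)%N -> (lam ^+ j <= C0 * s1 ^+ v)%R.
  move=> vj; rewrite mulrC ler_pdivlMr ?exprn_gt0//.
  apply: (@le_trans _ _ (s1 ^+ (n0 * j + n0))%R); last first.
    by apply: ler_wiXn2l => //; exact: ltW.
  rewrite exprD exprM; apply: ler_wpM2r; first by apply: exprn_ge0; exact: ltW.
  apply: lerXn2r => //; rewrite nnegrE; first exact: ltW.
  by apply: exprn_ge0; exact: ltW.
exists s, (fun w => C0 * (c1 w + c2 w))%R; split.
- by apply/andP.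
- by apply: measurable_funM; [exact: measurable_cst|exact: measurable_funD].
- by move=> w; rewrite mulr_gt0// addr_gt0.
have regV : {ae P, forall w, forall n, reg (thV n w)} by exact: ae_orbit.
apply: filterS3 regV c1H c2H => w rV c1w c2w n.
have bound j v b c : (v <= n0 * j + n0)%N -> (0 <= b)%R ->
    (s1 ^+ v * b / s ^+ n <= c)%R -> (c <= c1 w + c2 w)%R ->
    (0 < lam ^+ j)%R /\ (lam ^+ j * b <= C0 * (c1 w + c2 w) * s ^+ n)%R.
  move=> vj b0 cH cc; split; first by rewrite exprn_gt0.
  apply: (@le_trans _ _ (C0 * s1 ^+ v * b)%R).
    by rewrite ler_wpM2r// lamj.
  rewrite -!mulrA ler_wpM2l ?(ltW C00)//.
  by rewrite -ler_pdivrMr//; apply: le_trans cH _.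
split.
  have [j vj cj] := contracts_visits mphi u01 kappa0 n00 l0 conG n (rV n).
  exists (lam ^+ j)%R => //; apply: bound vj _ (c2w n) _ => //.
  by rewrite lerDr ltW.
have [j vj cj] := contracts_visits mphi u01 kappa0 n00 l0 conG n (rV 0%N).
exists (lam ^+ j)%R => //; apply: bound vj _ (c1w n) _ => //.
by rewrite lerDl ltW.
Qed.

End MainContraction.

(** * From the hypotheses on the potential and the random measures to [uniform_contraction] *)

Lemma random_probability_fiber {d} {Omega : measurableType d} {R : realType}
    {P : probability Omega R} (X : rtmc P) mu : random_probability X mu ->
  {ae P, forall w, probability_on_fiber X w (mu w)}.
Proof. by case. Qed.

Lemma probability_on_fiber_letters {d} {Omega : measurableType d} {R : realType}
    {P : probability Omega R} (X : rtmc P) w (M : set baire -> \bar R) :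
  probability_on_fiber X w M -> exists i, letters X w i.
Proof.
move=> pM; have M1 := probability_on_fiber_full pM.
have [x wx] : fiber X w !=set0.
  apply/set0P/negP => /eqP w0; case: pM => -[m Mm] _; move: M1.
  by rewrite w0 Mm// measure0 => /eqP; rewrite eq_sym onee_eq0.
by exists (x 0%N); have [] := wx 0%N.
Qed.

Lemma fiber_variation_le {d} {Omega : measurableType d} {R : realType}
    {P : probability Omega R} (X : rtmc P) (f : Omega -> baire -> R) n w (C : R) x y :
  fiber_variation X n f w <= C%:E -> fiber X w x -> fiber X w y ->
  (forall i, (i < n)%N -> x i = y i) -> (`|f w x - f w y| <= C)%R.
Proof.
move=> fC wx wy xy; rewrite -lee_fin; apply: le_trans fC.
by apply: ereal_sup_ubound; exists x, y.
Qed.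

Lemma fiber_variation_bounded {d} {Omega : measurableType d} {R : realType}
    {P : probability Omega R} (X : rtmc P) (f : Omega -> baire -> R) w :
  fiber_variation X 1 f w < +oo -> var1_bounded X f w.
Proof.
move=> foo; exists (fine (maxe 0 (fiber_variation X 1 f w))) => x y wx wy xy.
apply: (@fiber_variation_le _ _ _ _ X f 1 w) => //; last by case.
rewrite fineK ?le_max ?lexx ?orbT// ge0_fin_numE ?le_max ?lexx//.
by rewrite gt_max ltry.
Qed.

Theorem corollary3p2 (d : measure_display) (Omega : measurableType d)
    (R : realType) (P : probability Omega R) (X : rtmc P)
    (Obi Obp : set Omega) (r : R) (phi : Omega -> baire -> R)
    (hbip : bip X Obi Obp)
    (hr : (0 < r < 1)%R)
    (hphi : measurable_fun (total_space X) (fun p : Omega * baire => phi p.1 p.2))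
    (hH : Hhat X Obi Obp r phi)
    (hL1 : {ae P, forall w, forall x, fiber X (theta X w) x ->
             ruelle X phi w (cst 1) x = 1}) :
  exists (s : R) (c : Omega -> R),
    [/\ (0 < s < 1)%R,
        measurable_fun [set: Omega] c,
        (forall w, (0 < c w)%R) &
        forall mu nu : Omega -> set baire -> \bar R,
          random_probability X mu -> random_probability X nu ->
          forall n : nat, {ae P, forall w,
            vasershtein r (pull X phi n mu (iter n (thetaV X) w))
                          (pull X phi n nu (iter n (thetaV X) w))
              <= (c w * s ^+ n)%:E * vasershtein r (mu w) (nu w) /\
            vasershtein r (pull X phi n mu w) (pull X phi n nu w)
              <= (c w * s ^+ n)%:E *
                 vasershtein r (mu (iter n (theta X) w))
                               (nu (iter n (theta X) w))}].
Proof.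
(* Without any random probability measure the claim is vacuous. Otherwise [mu0] shows that almost
   every fibre, hence almost every alphabet, is nonempty. *)
have [[mu0 rp0]|norp] := pselect (exists mu, random_probability X mu); last first.
  exists 2^-1%R, (cst 1%R); split => //; first by apply/andP; split; lra.
  by move=> mu nu rmu; case: norp; exists mu.
have [mix _ [mObp Obp0] [I [finI _ bpI]]] := hbip.
have [[kappa [mkappa kappa0 ikappa holk]] var1] := hH.
have /andP[r0 r1] := hr.
(* With [u] the fourth root of [r], both [t = u ^ 2] and the square root of [t] used for the
   convergence of [past_sum] are powers of [u]. *)
pose u := Num.sqrt (Num.sqrt r).
have u0 : (0 < u)%R by rewrite !sqrtr_gt0.
have uE : (u ^+ 4 = r)%R.
  by rewrite -[4%N]/(2 * 2)%N exprM !sqr_sqrtr ?sqrtr_ge0// ltW.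
have u1 : (u < 1)%R.
  by rewrite ltNge; apply/negP => u1; move: r1; rewrite -uE ltNge exprn_ege1.
have u01 : (0 < u < 1)%R by apply/andP.
have ae_regular : {ae P, forall w, regular X phi u kappa w}.
  have fin := ae_past_sum X u01 mkappa kappa0 ikappa.
  apply: filterS2 (ae_has_successors X) (filterI hL1 (filterI holk fin)).
  move=> w suc [nw [holw finw]]; split=> // n x y n2 wx wy xy; rewrite uE.
  apply: le_trans (fiber_variation_le (holw n n2) wx wy xy) _.
  rewrite ler_wpM2r//; first by rewrite exprn_ge0// ltW.
  by rewrite lerDl invr_ge0 exprn_ge0// ltW.
have ae_reg : {ae P, forall w, orbit_regular X phi u kappa w}.
  exact: (ae_orbit (theta_measurable X) (@theta_preserving _ _ _ _ X)).
have ae_letters : {ae P, forall w, exists i, letters X w i}.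
  by apply: filterS (random_probability_fiber rp0) => w /probability_on_fiber_letters.
have ae_var1 : {ae P, forall w, Obp (theta X w) -> var1_bounded X phi w}.
  by apply: filterS var1 => w H Ow; apply: fiber_variation_bounded; apply: H; right.
have [n0 [v [M [k [n00 Mv PG]]]]] := good_block hphi u01 kappa0 mkappa finI bpI
  mObp Obp0 mix ae_reg ae_letters ae_var1.
(* The rate of [contracts_block] for [M' = k] and [eps = 1 / k.+1], the bounds built into
   [block_set]. *)
pose lam : R :=
  (Num.max (u ^+ 2) (1 - (expR (- k%:R) * k.+1%:R^-1) ^+ 2 / 2))%R.
have lam01 : (0 < lam < 1)%R.
  have e0 : (0 < expR (- k%:R) * k.+1%:R^-1 :> R)%R.
    by rewrite mulr_gt0 ?expR_gt0// invr_gt0 ltr0Sn.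
  apply/andP; split; first by rewrite lt_max exprn_gt0.
  rewrite gt_max; apply/andP; split; first by rewrite exprn_ilt1// ltW.
  by rewrite ltrBlDr ltrDl divr_gt0// exprn_gt0.
have conG w : block_set X phi u kappa n0 v M k w ->
    orbit_regular X phi u kappa w ->
    contracts X phi (u ^+ 4) (past X u kappa) n0 w lam.
  move=> [Bw Dw mass] rw.
  by apply: (contracts_block hphi u01 kappa0 rw n00 Mv Bw Dw _ mass); rewrite invr_ge0.
have [s [c [s01 mc c0 H]]] := uniform_contraction hphi u01 kappa0 mkappa ikappa
  ae_reg (measurable_block_set hphi u01 kappa0 mkappa n0 v M k) PG n00 lam01 conG.
exists s, c; split=> // mu nu rmu rnu n.
have munu : {ae P, forall w, probability_on_fiber X w (mu w) /\
                             probability_on_fiber X w (nu w)}.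
  by apply: filterS2 (random_probability_fiber rmu) (random_probability_fiber rnu).
have munun := ae_preserving_iter (theta_measurable X)
  (@theta_preserving _ _ _ _ X) n munu.
have regV := ae_preserving_iter (thetaV_measurable X) (thetaV_preserving X) n ae_reg.
apply: filterS3 (filterI ae_reg regV) H (filterI munu munun).
move=> w [rw rVw] /(_ n) [[l1 [l10 l1c] con1] [l2 [l20 l2c] con2]].
move=> [[muw nuw] [munw nunw]]; rewrite -uE.
have r01 : (0 < u ^+ 4 < 1)%R by rewrite uE.
have past1 w' m : orbit_regular X phi u kappa w' -> (1 <= past X u kappa (iter m (theta X) w'))%R.
  by move=> rw'; apply: past_ge1 => //; exact: orbit_regular_past.
split.
  (* The first inequality is the contraction from base point [thV n w], whose image under [th n] is
     [w]. *)
  have E := thVK X n w; rewrite /pull.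
  apply: le_trans (contracts_vasershtein hphi r01 l10 _ _ con1 _ _) _.
  + exact: (past1 _ 0%N).
  + by apply: lt_le_trans (past1 _ n rVw).
  + by rewrite E.
  + by rewrite E.
  by rewrite E lee_wpmul2r ?lee_fin// vasershtein_ge0.
apply: le_trans (contracts_vasershtein hphi r01 l20 _ _ con2 munw nunw) _.
+ exact: (past1 _ 0%N).
+ by apply: lt_le_trans (past1 _ n rw).
by rewrite lee_wpmul2r ?lee_fin// vasershtein_ge0.
Qed.
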